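(* Let $r\ge 2$ be an integer and let $l\in\{0,1,\dots,r-1\}$. There exist constants $C_1, C_2$, depending only on $l$ and $r$ (in particular not on $N$, $h$ or $u$), such that for every integer $N\ge 4r$, with $h=1/N$ and $P_h$ the $L^2$-projection operator onto $\mathcal{S}_h^r$: (i) $\|\partial_x^l(P_hu)\|\le C_1\|\partial_x^l u\|$ for all $u\in H^l_{per}$, and (ii) $\|\partial_x^l(P_hu)\|_\infty\le C_2\|\partial_x^l u\|_\infty$ for all $u\in W^l_\infty\cap H^l_{per}$.
   Context: Let $r\ge2$, $N\ge 4r$ be integers, $h=1/N$, $x_i=ih$ for $i=0,1,\dots,N$. Let $C^{k}_{per}$ be the space of $1$-periodic, $k$ times continuously differentiable functions and $C^{k}_{per}[0,1]$ the restrictions of such functions to $[0,1]$. Let $\mathbb{P}_{m}$ denote the polynomials of degree at most $m$. The space of $1$-periodic smooth splines of order $r$ is the $N$-dimensional space $$\mathcal{S}_h^r=\{v\in C^{r-2}_{per}[0,1] : v|_{(x_{i-1},x_i)}\in\mathbb{P}_{r-1},\ i=1,2,\dots,N\}.$$ $(\cdot,\cdot)$ and $\|\cdot\|$ denote the $L^2$ inner product and norm on $[0,1]$, and $\|\cdot\|_\infty$ denotes the $L^\infty$ norm on $[0,1]$. For integer $l\ge0$, $H^l_{per}$ is the $L^2$-based Sobolev space of order $l$ of $1$-periodic functions ($H^0_{per}=L^2_{per}$, the $1$-periodic functions that are square-integrable over one period), and $W^l_\infty$ is the $L^\infty$-based Sobolev space of order $l$ (weak derivatives up to order $l$ in $L^\infty$).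 The $L^2$ projection $P_h: L^2_{per}\to\mathcal{S}_h^r$ is defined by $(P_hu,\chi)=(u,\chi)$ for all $\chi\in\mathcal{S}_h^r$. Derivatives $\partial_x^l$ are weak derivatives; for elements of $\mathcal{S}_h^r$ and $l\le r-1$ they coincide with the piecewise (on each $(x_{i-1},x_i)$) derivatives. *)

(* Defs.v *)
From HB Require Import structures.
From mathcomp Require Import all_boot all_order all_algebra.
From mathcomp Require Import all_classical all_reals all_analysis.

Set Implicit Arguments.
Unset Strict Implicit.
Unset Printing Implicit Defensive.

Import Order.TTheory GRing.Theory Num.Theory.
Import numFieldNormedType.Exports.

Local Open Scope classical_set_scope.
Local Open Scope ring_scope.

(* Elements of L^2_per, H^l_per, ... are represented by 1-periodic measurable
   functions on the whole line (not by classes modulo a.e. equality). *)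

Section spaces.
Context {R : realType}.
Implicit Types (u v g chi phi : R -> R) (Om K : set R) (k l r N : nat).

Local Notation mu := (@lebesgue_measure R).

Definition lebesgue01 : {measure set (measurableTypeR R) -> \bar R} :=
  mrestr mu (measurable_itv `[0 : R, 1]).

Definition L2norm u : \bar R := 'N[lebesgue01]_(2%:E)[EFin \o u].
Definition Linfnorm u : \bar R := 'N[lebesgue01]_(+oo)[EFin \o u].

Definition inner01 u v : R := \int[mu]_(x in `[0, 1]) (u x * v x).

Definition classC k u : Prop :=
  (forall j, (j < k)%N -> forall x, derivable (derive1n j u) x 1) /\
  continuous (derive1n k u).

Definition test_function Om phi : Prop :=
  (forall k, classC k phi) /\
  exists K, [/\ compact K, K `<=` Om & forall x, ~ K x -> phi x = 0].

(* [weak_derivative Om l u g]: g is (a representative of) the l-th weak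
   derivative of u on the open set Om. *)
Definition weak_derivative Om l u g : Prop :=
  [/\ locally_integrable Om u, locally_integrable Om g &
    forall phi, test_function Om phi ->
      \int[mu]_(x in Om) (u x * derive1n l phi x) =
      (-1) ^+ l * \int[mu]_(x in Om) (g x * phi x)].

Definition L2_per u : Prop :=
  periodic u 1 /\ u \in Lfun lebesgue01 2%:E.

(* For periodic functions the weak derivative is taken on the whole line, so
   that the periodic matching at the integers is part of the condition. *)
Definition H_per l u : Prop :=
  L2_per u /\
  forall j, (j <= l)%N -> exists2 g, L2_per g & weak_derivative setT j u g.

(* The space W^l_infty over the open unit interval; no periodicity. *)
Definition W_inf l u : Prop :=
  u \in Lfun lebesgue01 +oo%E /\
  forall j, (j <= l)%N ->
    exists2 g, g \in Lfun lebesgue01 +oo%E & weak_derivative `]0, 1[ j u g.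

Definition node N i : R := i%:R / N%:R.

(* Smooth splines, identified with their 1-periodic extensions to the line. *)
Definition spline r N v : Prop :=
  [/\ periodic v 1, classC (r - 2) v &
    forall i, (1 <= i <= N)%N -> exists2 q : {poly R}, (size q <= r)%N &
      forall x, node N i.-1 < x < node N i -> v x = q.[x]].

(* [L2_projection r N u v]: v = P_h u with h = 1/N. *)
Definition L2_projection r N u v : Prop :=
  spline r N v /\
  forall chi, spline r N chi -> inner01 v chi = inner01 u chi.

End spaces.

(* Main.v *)
(* The splines of degree n on the grid of mesh h = 1/N are v = sum_j c_j B(x/h - j)
   with B the cardinal B-spline, and differentiating v acts on the coefficients as
   the backward difference, with B replaced by the B-spline of lower degree.
   Difference operators commute with the Gram operator G of the B-splines, so the
   coefficients d = h^{-l} nabla^l c of the l-th derivative of P_h u solve G d = b,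
   where b_j is (up to normalization) the integral of the l-th derivative of u
   against the B-spline of degree n + l: the l derivatives put on u are gained from
   the l-th difference of the degree n B-splines being the l-th derivative of the
   degree n + l one.  Local linear independence of B-splines bounds G from below
   in l^2 cell by cell; testing with w d, where w is a slowly varying weight that
   decays exponentially away from one index, turns this into an l^infinity bound
   independent of N. *)
Require Import Defs.
From mathcomp Require Import all_boot all_order all_algebra.
From mathcomp Require Import all_classical all_reals all_analysis.
From mathcomp Require Import measurable_realfun ess_sup_inf ring lra zify.

Set Implicit Arguments.
Unset Strict Implicit.
Unset Printing Implicit Defensive.

Import Order.TTheory GRing.Theory Num.Theory.
Import numFieldNormedType.Exports.

Local Open Scope classical_set_scope.
Local Open Scope ring_scope.

(** * Polynomial pieces of B-splines *)

Section pieces.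
Context {R : realType}.
Implicit Types (p q : {poly R}) (c e : int -> R) (n k : nat) (i : int).

(** The derivative of [P_h u] is not the projection of the derivative of [u]. The way out is to read
    its coefficient sequence [d] in two degrees: in degree [n - l] it gives the derivative itself,
    in degree [n] it solves a Gram system to which coercivity applies. Coercivity alone lives in
    l^2, and passing from there to a maximum would cost a power of [N]. Inserting a weight costs a
    commutator proportional to the relative variation of the weight over [n + 1] neighbouring
    indices. A rate of decay fixed by [n] alone therefore suffices, and the total mass of the weight
    is then bounded independently of [N]. The analytic obstacle is that a B-spline is not infinitely
    differentiable, hence not a test function, and that weak derivatives are defined on the whole
    line while the projection lives on one period. Single B-splines are mollified, tested on the
    line and summed over a period, which requires supports no longer than a period. The weak
    derivatives in the estimates are arbitrary representatives, so almost everywhere uniqueness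
    enters for [u] as well as for [P_h u]. *)

Definition pint p : {poly R} := \poly_(i < (size p).+1) (p`_i.-1 / i%:R).

Lemma coef_pint p j : (pint p)`_j = p`_j.-1 / j%:R.
Proof.
rewrite coef_poly; case: ltnP => //; case: j => // j.
by rewrite ltnS => pj; rewrite [p`__]nth_default ?mul0r.
Qed.

Lemma deriv_pint p : (pint p)^`() = p.
Proof.
apply/polyP => j; rewrite coef_deriv coef_pint /=.
by rewrite -[LHS]mulr_natr divfK // pnatr_eq0.
Qed.

(** The constant coefficient of [pint p] is a quotient by [0%:R], and inversion sends 0 to 0; so
    [pint p] is the primitive that vanishes at 0. *)
Lemma horner_pint0 p : (pint p).[0] = 0.
Proof. by rewrite horner_coef0 coef_pint invr0 mulr0. Qed.

Lemma size_pint p : (size (pint p) <= (size p).+1)%N.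
Proof. exact: size_poly. Qed.

Lemma pint0 : pint 0 = 0.
Proof. by apply/polyP => j; rewrite coef_pint !coef0 mul0r. Qed.

Lemma pint1 : pint 1 = 'X.
Proof.
apply/polyP => -[|j]; rewrite coef_pint coefX coef1 ?invr0 ?mulr0 //=.
by case: j => [|j]; rewrite /= ?mulr1n ?mulr0n ?mul0r ?divr1.
Qed.

Lemma pintD p q : pint (p + q) = pint p + pint q.
Proof. by apply/polyP => j; rewrite coefD !coef_pint coefD mulrDl. Qed.

Lemma pintZ a p : pint (a *: p) = a *: pint p.
Proof. by apply/polyP => j; rewrite coefZ !coef_pint coefZ mulrA. Qed.

Lemma pint_sum I (s : seq I) (a : I -> R) (p : I -> {poly R}) :
  pint (\sum_(j <- s) a j *: p j) = \sum_(j <- s) a j *: pint (p j).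
Proof.
elim: s => [|j s IH]; first by rewrite !big_nil pint0.
by rewrite !big_cons pintD pintZ IH.
Qed.

(* The restriction of the cardinal B-spline of degree [n], supported in
   [[0, n + 1]], to [[k, k + 1]], translated to [[0, 1]]. *)
Fixpoint bpiece n k : {poly R} :=
  if n is n'.+1 then
    pint (bpiece n' k) +
    if k is k'.+1 then (pint (bpiece n' k')).[1]%:P - pint (bpiece n' k')
    else 0
  else (k == 0)%:R.

(* On the unit cell [[i, i + 1]], the spline of degree [n] with B-spline
   coefficients [c]. *)
Definition spiece n c i : {poly R} :=
  \sum_(k < n.+1) c (i - k%:Z) *: bpiece n k.

Definition nabla c : int -> R := fun i => c i - c (i - 1).

Lemma bpiece_gt n k : (n < k)%N -> bpiece n k = 0.
Proof.
elim: n k => [|n IH] [|k] //=; rewrite ltnS => nk.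
by rewrite (IH k) // (IH k.+1) 1?ltnW // pint0 horner0 subr0 addr0.
Qed.

(** The recursion of [bpiece] is the moving average over [[x - 1, x]], split at the knot inside that
    window; differentiating it leaves the values at the two ends of the window. *)
Lemma deriv_bpiece n k :
  (bpiece n.+1 k)^`() = bpiece n k - (if k is k'.+1 then bpiece n k' else 0).
Proof.
rewrite /= derivD deriv_pint; case: k => [|k]; first by rewrite deriv0 subr0 addr0.
by rewrite derivB derivC deriv_pint sub0r.
Qed.

Lemma size_bpiece n k : (size (bpiece n k) <= n.+1)%N.
Proof.
elim: n k => [|n IH] k /=.
  by rewrite -polyC_natr; exact: size_polyC_leq1.
have H j : (size (pint (bpiece n j)) <= n.+2)%N.
  by apply: leq_trans (size_pint _) _; rewrite ltnS.
rewrite (leq_trans (size_polyD _ _)) // geq_max H; case: k => [|k].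
  by rewrite size_poly0.
rewrite (leq_trans (size_polyD _ _)) // geq_max size_polyN H andbT.
by rewrite (leq_trans (size_polyC_leq1 _)).
Qed.

Lemma bpiece_glue n k : (bpiece n.+1 k).[1] = (bpiece n.+1 k.+1).[0].
Proof.
rewrite /= !(hornerD, hornerN, hornerC) !horner_pint0 subr0 add0r.
by case: k => [|k]; rewrite !(hornerD, hornerN, hornerC) ?subrr addr0.
Qed.

Lemma bpiece00 n : (bpiece n.+1 0).[0] = 0.
Proof. by rewrite /= addr0 horner_pint0. Qed.

(** In the recursion the variable parts of consecutive pieces cancel. What remains is the integral
    over one cell of the sum in lower degree, which is 1 by induction. *)
Lemma sum_bpiece n : \sum_(k < n.+1) bpiece n k = 1.
Proof.
elim: n => [|n IH]; first by rewrite big_ord1.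
rewrite /= big_split /= big_ord_recr /= (bpiece_gt (ltnSn n)) pint0 addr0.
rewrite [X in _ + X]big_ord_recl /= add0r -big_split /=.
under eq_bigr do rewrite addrCA subrr addr0.
have -> : \sum_(k < n.+1) (pint (bpiece n k)).[1]%:P
        = ((pint (\sum_(k < n.+1) bpiece n k)).[1])%:P.
  under [\sum_(k < n.+1) bpiece n k]eq_bigr do rewrite -[bpiece _ _]scale1r.
  rewrite pint_sum horner_sum rmorph_sum /=.
  by apply: eq_bigr => k _; rewrite scale1r.
by rewrite IH pint1 hornerX.
Qed.

Lemma size_spiece n c i : (size (spiece n c i) <= n.+1)%N.
Proof.
apply: (leq_trans (size_sum _ _ _)); apply/bigmax_leqP => k _.
exact: leq_trans (size_scale_leq _ _) (size_bpiece _ _).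
Qed.

Lemma spiece_ext n c e i :
  (forall k, (k <= n)%N -> c (i - k%:Z) = e (i - k%:Z)) ->
  spiece n c i = spiece n e i.
Proof. by move=> ce; apply: eq_bigr => k _; rewrite ce // -ltnS. Qed.

Lemma spieceD n c e i :
  spiece n (fun j => c j + e j) i = spiece n c i + spiece n e i.
Proof. by rewrite -big_split; apply: eq_bigr => k _; rewrite scalerDl. Qed.

Lemma spieceZ n a c i : spiece n (fun j => a * c j) i = a *: spiece n c i.
Proof. by rewrite scaler_sumr; apply: eq_bigr => k _; rewrite scalerA. Qed.

Lemma spieceB n c e i :
  spiece n (fun j => c j - e j) i = spiece n c i - spiece n e i.
Proof.
rewrite -[- spiece n e i]scaleN1r -spieceZ -spieceD.
by apply: spiece_ext => k _; rewrite mulN1r.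
Qed.

Lemma spiece_cst n a i : spiece n (fun=> a) i = a%:P.
Proof. by rewrite /spiece -scaler_sumr sum_bpiece alg_polyC. Qed.

Lemma spiece_shift n c m i : spiece n (fun j => c (j + m)) i = spiece n c (i + m).
Proof. by apply: eq_bigr => k _; rewrite addrAC. Qed.

Lemma deriv_spiece n c i : (spiece n.+1 c i)^`() = spiece n (nabla c) i.
Proof.
rewrite /spiece linear_sum /=.
under eq_bigr do rewrite derivZ deriv_bpiece scalerBr.
rewrite sumrB big_ord_recr /= (bpiece_gt (ltnSn n)) scaler0 addr0.
rewrite [X in _ - X]big_ord_recl /= scaler0 add0r -sumrB.
apply: eq_bigr => k _; rewrite -scalerBl /nabla; congr ((_ - c _) *: _).
by rewrite /bump /=; lia.
Qed.

Lemma derivn_spiece n l c i :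
  (spiece (n + l) c i)^`(l) = spiece n (iter l nabla c) i.
Proof.
elim: l n => [|l IH] n; first by rewrite addn0 derivn0.
by rewrite derivnS addnS -addSn IH deriv_spiece.
Qed.

Lemma spiece_glue n c i : (spiece n.+1 c i).[1] = (spiece n.+1 c (i + 1)).[0].
Proof.
rewrite /spiece !horner_sum big_ord_recr [RHS]big_ord_recl /=.
rewrite hornerZ bpiece_glue bpiece_gt // horner0 mulr0 addr0.
rewrite hornerZ bpiece00 mulr0 add0r.
apply: eq_bigr => k _; rewrite !hornerZ bpiece_glue; congr (c _ * _).
by rewrite /bump /=; lia.
Qed.

(** Local linear independence. Differentiating gives a vanishing combination of degree [n] whose
    coefficients are differences of the [a k], so by induction all [a k] are equal; the partition of
    unity then forces their common value to be 0. *)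
Lemma bpiece_free n (a : nat -> R) :
  \sum_(k < n.+1) a k *: bpiece n k = 0 -> forall k, (k <= n)%N -> a k = 0.
Proof.
elim: n a => [|n IH] a a0.
  move=> k; rewrite leqn0 => /eqP ->; move: a0; rewrite big_ord1 /= alg_polyC.
  by move/eqP; rewrite polyC_eq0 => /eqP.
have aS k : (k <= n)%N -> a k.+1 = a k.
  have /(IH (fun k => a k - a k.+1)) H :
      \sum_(k < n.+1) (a k - a k.+1) *: bpiece n k = 0.
    have : (\sum_(k < n.+2) a k *: bpiece n.+1 k)^`() = 0 by rewrite a0 deriv0.
    rewrite linear_sum /=.
    under eq_bigr do rewrite derivZ deriv_bpiece scalerBr.
    rewrite sumrB big_ord_recr /= (bpiece_gt (ltnSn n)) scaler0 addr0.
    rewrite [X in _ - X]big_ord_recl /= scaler0 add0r -sumrB => H.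
    by rewrite -[RHS]H; apply: eq_bigr => j _; rewrite -scalerBl.
  by move=> /H /eqP; rewrite subr_eq0 => /eqP.
have aE k : (k <= n.+1)%N -> a k = a 0.
  by elim: k => // k IHk kn; rewrite aS // IHk // ltnW.
suff a00 : a 0%N = 0 by move=> k /aE ->.
move: a0; under eq_bigr => k _ do rewrite aE -1?ltnS //.
rewrite -scaler_sumr sum_bpiece alg_polyC => /eqP.
by rewrite polyC_eq0 => /eqP.
Qed.

(** * The inner product over the unit cell and local stability of the pieces *)

Definition ip p q : R := (pint (p * q)).[1].

Lemma ipC p q : ip p q = ip q p.
Proof. by rewrite /ip mulrC. Qed.

Lemma ipDr p q q' : ip p (q + q') = ip p q + ip p q'.
Proof. by rewrite /ip mulrDr pintD hornerD. Qed.

Lemma ipZr a p q : ip p (a *: q) = a * ip p q.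
Proof. by rewrite /ip -scalerAr pintZ hornerZ. Qed.

Lemma ip_suml I (s : seq I) (a : I -> R) (p : I -> {poly R}) q :
  ip (\sum_(j <- s) a j *: p j) q = \sum_(j <- s) a j * ip (p j) q.
Proof.
rewrite /ip mulr_suml; under eq_bigr do rewrite -scalerAl.
by rewrite pint_sum horner_sum; apply: eq_bigr => j _; rewrite hornerZ.
Qed.

Lemma ip_sumr I (s : seq I) (a : I -> R) (p : I -> {poly R}) q :
  ip q (\sum_(j <- s) a j *: p j) = \sum_(j <- s) a j * ip q (p j).
Proof. by rewrite ipC ip_suml; under eq_bigr do rewrite ipC. Qed.

Lemma pint_sqr_ndecr p x y : x <= y -> (pint (p * p)).[x] <= (pint (p * p)).[y].
Proof.
move=> xy; apply: (@ger0_derive1_ndecr _ (horner (pint (p * p))) x y);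
  rewrite ?lexx //.
- by move=> z _; rewrite -derivE deriv_pint hornerM -expr2 sqr_ge0.
- by apply: continuous_subspaceT; exact: continuous_horner.
Qed.

Lemma ip_ge0 p : 0 <= ip p p.
Proof. by rewrite -(horner_pint0 (p * p)); exact: pint_sqr_ndecr. Qed.

Lemma poly_eq01 p q : (forall x, 0 < x < 1 -> p.[x] = q.[x]) -> p = q.
Proof.
move=> pq; apply/eqP; rewrite -subr_eq0; apply/eqP.
(* As many distinct zeros in [(0, 1)] as needed: 1/2, 1/3, and so on. *)
pose s : seq R := [seq (k.+2%:R)^-1 | k <- iota 0 (size (p - q))].
apply: (@roots_geq_poly_eq0 _ _ s).
- apply/allP => _ /mapP[k _ ->]; rewrite /root hornerD hornerN pq ?subrr //.
  by rewrite invr_gt0 ltr0n /= invf_lt1 ?ltr0n // ltr1n.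
- rewrite map_inj_uniq ?iota_uniq // => j k /invr_inj /eqP.
  by rewrite eqr_nat !eqSS => /eqP.
- by rewrite size_map size_iota.
Qed.

(** The primitive of [p * p] is nondecreasing with equal values at 0 and 1, hence zero on the whole
    cell, and so is its derivative. *)
Lemma ip_eq0 p : ip p p = 0 -> p = 0.
Proof.
move=> p0; have P0 : pint (p * p) = 0.
  apply: poly_eq01 => x /andP[x0 x1]; rewrite horner0; apply/le_anti.
  rewrite -{1}p0 -(horner_pint0 (p * p)).
  by rewrite !pint_sqr_ndecr // ltW.
have : p * p = 0 by rewrite -(deriv_pint (p * p)) P0 deriv0.
by move/eqP; rewrite mulf_eq0 orbb => /eqP.
Qed.

Lemma ip_CauchySchwarz p q : ip p q ^+ 2 <= ip p p * ip q q.
Proof.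
have := ip_ge0 (ip q q *: p + (- ip p q) *: q).
rewrite ipDr !ipZr (ipC (_ + _) p) (ipC (_ + _) q) !ipDr !ipZr (ipC q p).
set X := ip q q; set Y := ip p q; set Z := ip p p.
have : 0 <= X by exact: ip_ge0.
rewrite le_eqVlt => /predU1P[X0|X_gt0].
  have q0 : q = 0 by apply: ip_eq0; rewrite -/X -X0.
  have -> : Y = 0 by rewrite /Y /ip q0 mulr0 pint0 horner0.
  by rewrite expr0n /= -X0 !mulr0.
have -> : X * (X * Z + - Y * Y) + - Y * (X * Y + - Y * X) =
    X * (Z * X - Y ^+ 2) by ring.
by rewrite pmulr_rge0 // subr_ge0.
Qed.

Lemma sqr_sum_le m (x : 'I_m -> R) :
  (\sum_j x j) ^+ 2 <= m%:R * \sum_j x j ^+ 2.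
Proof.
have : 0 <= \sum_j \sum_k (x j - x k) ^+ 2.
  by rewrite sumr_ge0 // => j _; rewrite sumr_ge0 // => k _; rewrite sqr_ge0.
under eq_bigr => j _.
  under eq_bigr => k _ do rewrite sqrrB.
  rewrite !big_split /= sumr_const sumrN sumrMnl -mulr_sumr card_ord.
  over.
rewrite !big_split /= sumrN sumr_const !sumrMnl -mulr_suml -expr2 card_ord.
by rewrite -[_ *+ 2]mulr_natl -[_ *+ m]mulr_natl; lra.
Qed.

Definition gram n : 'M[R]_n.+1 := \matrix_(j, k) ip (bpiece n j) (bpiece n k).

Lemma gram_unit n : gram n \in unitmx.
Proof.
rewrite unitmxE unitfE; apply/negP => /det0P[v v0 vG].
pose s := \sum_(k < n.+1) v 0 k *: bpiece n k.
have s0 : s = 0.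
  apply: ip_eq0; rewrite {2}/s ip_sumr big1 // => k _.
  suff -> : ip s (bpiece n k) = 0 by rewrite mulr0.
  have := congr1 (fun M : 'rV_n.+1 => M 0 k) vG; rewrite !mxE => <-.
  by rewrite ip_suml; apply: eq_bigr => j _; rewrite !mxE.
case/negP: v0; apply/eqP/rowP => k; rewrite mxE.
have := @bpiece_free n (fun j => v 0 (inord j)) _ k (ltn_ord k).
rewrite inord_val; apply; rewrite -[RHS]s0.
by apply: eq_bigr => j _; rewrite inord_val.
Qed.

(** The inverse Gram matrix of the pieces recovers each coefficient from the inner products of the
    combination with the pieces, which Cauchy-Schwarz controls. The summand 1 in [K] only secures
    positivity. *)
Lemma bpiece_stable n : exists2 K : R, 0 < K &
  forall (a : nat -> R) k, (k <= n)%N ->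
    a k ^+ 2 <= K * ip (\sum_(j < n.+1) a j *: bpiece n j)
                       (\sum_(j < n.+1) a j *: bpiece n j).
Proof.
pose G' := invmx (gram n).
pose B j := ip (bpiece n j) (bpiece n j).
pose K := 1 + \sum_(k < n.+1) n.+1%:R * \sum_(j < n.+1) (G' j k ^+ 2 * B j).
have B0 j : 0 <= B j by exact: ip_ge0.
have K0 (k : 'I_n.+1) : 0 <= n.+1%:R * \sum_(j < n.+1) (G' j k ^+ 2 * B j).
  by rewrite mulr_ge0 ?ler0n // sumr_ge0 // => j _; rewrite mulr_ge0 ?sqr_ge0.
exists K.
  by rewrite ltr_wpDr // sumr_ge0.
move=> a k kn; set s := \sum_(j < n.+1) _; have s0 := ip_ge0 s.
pose k' : 'I_n.+1 := Ordinal (kn : (k < n.+1)%N).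
have ak : a k = \sum_(j < n.+1) ip s (bpiece n j) * G' j k'.
  pose v : 'rV_n.+1 := \row_j a j.
  have -> : a k = (v *m gram n *m G') 0 k'.
    by rewrite -mulmxA mulmxV ?gram_unit // mulmx1 mxE.
  rewrite mxE; apply: eq_bigr => j _; congr (_ * _).
  by rewrite mxE ip_suml; apply: eq_bigr => m _; rewrite !mxE.
rewrite ak; apply: le_trans (sqr_sum_le _) _.
have : n.+1%:R * \sum_(j < n.+1) (ip s (bpiece n j) * G' j k') ^+ 2 <=
    (n.+1%:R * \sum_(j < n.+1) (G' j k' ^+ 2 * B j)) * ip s s.
  rewrite -mulrA ler_wpM2l ?ler0n // mulr_suml ler_sum // => j _.
  rewrite exprMn mulrC -mulrA ler_wpM2l ?sqr_ge0 // mulrC.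
  exact: ip_CauchySchwarz.
move/le_trans; apply; rewrite ler_wpM2r // /K [X in 1 + X](bigD1 k') //= addrCA lerDl.
by rewrite addr_ge0 // sumr_ge0.
Qed.

End pieces.

(** * Classical derivatives *)

Section derivatives.
Context {R : realType}.
Implicit Types (f g P Q : R -> R) (k n : nat).

(** A form without quotients and with [y = x] allowed, so that information on the two sides of a
    knot can be glued. *)
Lemma is_deriveP f (x d : R) :
  is_derive x 1 f d <->
  (forall e, 0 < e -> exists2 r, 0 < r & forall y, `|y - x| < r ->
     `|f y - f x - d * (y - x)| <= e * `|y - x|).
Proof.
have E h : h != 0 ->
    `|d - h^-1 *: ((f \o shift x) (h *: 1) - f x)| =
    `|f (h + x) - f x - d * h| / `|h|.
  move=> h0; rewrite -normfV -normrM distrC; congr `|_|.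
  by rewrite /= /GRing.scale /= mulr1; field.
split=> [[df dE] e e0|H].
  have : h^-1 *: ((f \o shift x) (h *: 1) - f x) @[h --> 0^'] --> d.
    by rewrite -dE; exact: df.
  move=> /cvgrPdist_le /(_ e e0) [r /= r0 rH]; exists r => // y yx.
  have [->|yNx] := eqVneq y x; first by rewrite !subrr mulr0 subr0 normr0 mulr0.
  have yx0 : y - x != 0 by rewrite subr_eq0.
  have := rH (y - x); rewrite /= sub0r normrN => /(_ yx yx0).
  by rewrite E // subrK ler_pdivrMr ?normr_gt0.
have C : h^-1 *: ((f \o shift x) (h *: 1) - f x) @[h --> 0^'] --> d.
  apply/cvgrPdist_le => e /H[r r0 rH]; exists r => //= h.
  rewrite /= sub0r normrN => hr h0; rewrite E // ler_pdivrMr ?normr_gt0 //.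
  by have := rH (h + x); rewrite addrK; apply.
apply: DeriveDef; first by apply/cvg_ex; exists d.
exact/cvg_lim.
Qed.

Lemma is_derive_glue f P Q (x d r : R) : 0 < r ->
  is_derive x 1 P d -> is_derive x 1 Q d ->
  (forall y, x - r < y <= x -> f y = P y) ->
  (forall y, x <= y < x + r -> f y = Q y) -> is_derive x 1 f d.
Proof.
move=> r0 /is_deriveP dP /is_deriveP dQ fP fQ; apply/is_deriveP => e e0.
have [r1 r10 H1] := dP e e0; have [r2 r20 H2] := dQ e e0.
exists (Num.min r (Num.min r1 r2)); first by rewrite !lt_min r0 r10.
move=> y; rewrite !lt_min => /and3P[yr y1 y2].
have /ltr_normlP[yr1 yr2] := yr.
have [yx|xy] := leP y x.
  rewrite (fP y) ?(fP x); [exact: H1|lra|lra].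
rewrite (fQ y) ?(fQ x); [exact: H2|lra|lra].
Qed.

Lemma is_derive_eq_itv f g (a b x d : R) : a < x < b ->
  (forall y, a < y < b -> f y = g y) -> is_derive x 1 g d -> is_derive x 1 f d.
Proof.
move=> /andP[ax xb] fg dg.
have r0 : 0 < Num.min (x - a) (b - x) by rewrite lt_min !subr_gt0 ax.
by apply: (is_derive_glue r0 dg dg) => y; case/andP=> y1 y2; apply: fg;
  [move: y1; rewrite ltrBlDl -ltrBlDr lt_min => /andP[]|
   move: y2; rewrite -ltrBlDl lt_min => /andP[]]; lra.
Qed.

Lemma derive1_is_derive f (x : R) : derivable f x 1 -> is_derive x 1 f ((derive1 f) x).
Proof. by move=> df; rewrite derive1E; exact: derivableP. Qed.

Lemma is_derive_derive1 f (df : R -> R) :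
  (forall x : R, is_derive x 1 f (df x)) -> (derive1 f) = df.
Proof. by move=> H; apply/funext => x; rewrite derive1E; case: (H x). Qed.

Lemma is_derive_affine f a b (x d : R) :
  is_derive (a * x + b) 1 f d -> is_derive x 1 (fun y => f (a * y + b)) (d * a).
Proof.
move=> df; have da : is_derive x 1 (fun y => a * y + b) a.
  have -> : (fun y => a * y + b) = horner (a *: 'X + b%:P).
    by apply/funext => y; rewrite !hornerE.
  by apply: is_derive_eq; rewrite derivD derivZ derivX derivC !hornerE.
exact: (@is_derive1_comp _ f (fun y => a * y + b) x d a).
Qed.

Lemma classC0 f : classC 0 f <-> continuous f.
Proof. by split=> [[]|cf]; [|split]. Qed.

Lemma classCS k f :
  classC k.+1 f <-> (forall x : R, derivable f x 1) /\ classC k (derive1 f).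
Proof.
have E j : derive1n j (derive1 f) = derive1n j.+1 f by rewrite /derive1n iterSr.
split=> [[df cf]|[df [df' cf']]].
  split; first exact: (df 0%N).
  split; last by rewrite E.
  by move=> j jk x; rewrite E; exact: df.
split; last by rewrite -E.
by move=> [|j] jk x //; rewrite -E; exact: df'.
Qed.

Lemma classC_is_derive k f (df : R -> R) :
  (forall x : R, is_derive x 1 f (df x)) -> classC k df -> classC k.+1 f.
Proof.
move=> H Cdf; apply/classCS; split; first by move=> x; case: (H x).
by rewrite (is_derive_derive1 H).
Qed.

Lemma classCS_is_derive k f (x : R) : classC k.+1 f -> is_derive x 1 f ((derive1 f) x).
Proof. by case/classCS=> df _; exact: derive1_is_derive. Qed.

Lemma classCS_derive1 k f : classC k.+1 f -> classC k (derive1 f).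
Proof. by case/classCS. Qed.

Lemma classCW k f : classC k.+1 f -> classC k f.
Proof.
elim: k f => [|k IH] f /classCS[df cf].
  apply/classC0 => x; apply: differentiable_continuous.
  exact/derivable1_diffP.
by apply/classCS; split => //; exact: IH.
Qed.

Lemma classC_leq j k f : (j <= k)%N -> classC k f -> classC j f.
Proof.
by move=> /subnK <-; elim: (k - j)%N => // m IH /classCW.
Qed.

Lemma classC_continuous k f : classC k f -> continuous f.
Proof.
by elim: k => [|k IH] H; [exact/classC0|exact: IH (classCW H)].
Qed.

Lemma classC_derive1n k l f : classC (k + l) f -> classC k (derive1n l f).
Proof.
elim: l f => [|l IH] f; first by rewrite addn0.
by rewrite addnS => /classCS_derive1 /IH; rewrite /derive1n iterSr.
Qed.

Lemma classC_cst k (a : R) : classC k (fun=> a).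
Proof.
elim: k a => [|k IH] a; first by apply/classC0; exact: cst_continuous.
by apply: (classC_is_derive _ (IH 0)) => x; exact: is_derive_cst.
Qed.

Lemma classCD k f g : classC k f -> classC k g -> classC k (fun x => f x + g x).
Proof.
elim: k f g => [|k IH] f g.
  by move=> /classC0 cf /classC0 cg; apply/classC0 => x; exact: (cvgD (cf x) (cg x)).
move=> Cf Cg; have Cf' := classCS_derive1 Cf; have Cg' := classCS_derive1 Cg.
apply: classC_is_derive (IH _ _ Cf' Cg') => x.
exact: (is_deriveD (classCS_is_derive x Cf) (classCS_is_derive x Cg)).
Qed.

Lemma classCM k f g : classC k f -> classC k g -> classC k (fun x => f x * g x).
Proof.
elim: k f g => [|k IH] f g.
  by move=> /classC0 cf /classC0 cg; apply/classC0 => x; exact: (cvgM (cf x) (cg x)).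
move=> Cf Cg; have Cf' := classCS_derive1 Cf; have Cg' := classCS_derive1 Cg.
apply: (classC_is_derive _
  (classCD (IH _ _ Cf' (classCW Cg)) (IH _ _ (classCW Cf) Cg'))) => x.
apply: (is_derive_eq (is_deriveM (classCS_is_derive x Cf) (classCS_is_derive x Cg))).
by rewrite /GRing.scale /= addrC; congr (_ + _); rewrite mulrC.
Qed.

Lemma classCZ k (a : R) f : classC k f -> classC k (fun x => a * f x).
Proof. by apply: classCM; exact: classC_cst. Qed.

Lemma classCB k f g : classC k f -> classC k g -> classC k (fun x => f x - g x).
Proof.
move=> Cf /(classCZ (-1)) Cg.
rewrite (_ : (fun x => _) = fun x => f x + (-1) * g x); first exact: classCD.
by apply/funext => x; rewrite mulN1r.
Qed.

Lemma classCV k f : (forall x, f x != 0) -> classC k f ->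
  classC k (fun x => (f x)^-1).
Proof.
move=> f0; elim: k => [|k IH] Cf.
  move/classC0: Cf => cf; apply/classC0 => x; exact: (cvgV (f0 x) (cf x)).
have CV := IH (classCW Cf).
apply: (classC_is_derive _
  (classCM (classCZ (-1) (classCS_derive1 Cf)) (classCM CV CV))) => x.
apply: (is_derive_eq (is_deriveV (f0 x) (classCS_is_derive x Cf))).
rewrite /GRing.scale /= mulN1r -invfM -expr2.
by rewrite mulrC mulrN mulNr.
Qed.

Lemma classC_affine k f a b : classC k f -> classC k (fun x => f (a * x + b)).
Proof.
elim: k f => [|k IH] f.
  move=> /classC0 cf; apply/classC0 => x.
  apply: (@continuous_comp _ _ _ (fun y => a * y + b) f); last exact: cf.
  by apply: cvgD; [apply: cvgM; [exact: cvg_cst|exact: cvg_id]|exact: cvg_cst].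
move=> Cf; apply: (classC_is_derive _ (classCZ a (IH _ (classCS_derive1 Cf)))).
move=> x; rewrite mulrC; apply: is_derive_affine.
exact: classCS_is_derive Cf.
Qed.

Lemma derive1n_affine k l f a b : (l <= k)%N -> classC k f ->
  derive1n l (fun x => f (a * x + b)) =
  fun x => a ^+ l * derive1n l f (a * x + b).
Proof.
elim: l => [|l IH] lk Cf; first by apply/funext => x; rewrite mul1r.
rewrite derive1nS IH ?(ltnW lk) //; apply: is_derive_derive1 => x.
have : classC 1 (derive1n l f).
  by apply: classC_derive1n; rewrite add1n; exact: classC_leq lk Cf.
move=> /(@classCS_is_derive _ _ (a * x + b)) /is_derive_affine H.

apply: (is_derive_eq (is_deriveZ (a ^+ l) H)).
by rewrite /GRing.scale /= exprSr -derive1nS; ring.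
Qed.

End derivatives.

(** * A smooth step *)

Section smooth_step.
Context {R : realType}.
Implicit Types (p : {poly R}) (k : nat) (e x : R).

(** Each monomial satisfies [y^i <= i! exp y], by comparison with a single term of the exponential
    series. *)
Lemma horner_expRN_bounded p : exists2 C : R, 0 <= C &
  forall y, 0 <= y -> `|p.[y]| * expR (- y) <= C.
Proof.
exists (\sum_(i < size p) `|p`_i| * i`!%:R).
  by rewrite sumr_ge0 // => i _; rewrite mulr_ge0.
move=> y y0; rewrite expRN ler_pdivrMr ?expR_gt0 // horner_coef.
apply: le_trans (ler_norm_sum _ _ _) _; rewrite mulr_suml ler_sum // => i _.
rewrite normrM -mulrA ler_wpM2l // normrX ger0_norm //.
case: (i : nat) => [|j]; first by rewrite expr0 mul1r -expR0 ler_expR.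
rewrite mulrC -ler_pdivrMr ?ltr0n ?fact_gt0 //.
by apply: le_trans (expR_ge1Dxn j y0); rewrite lerDr.
Qed.

(* All derivatives of the step [exp (- 1 / x)] are of this form. *)
Definition flat p x : R := if 0 < x then p.[x^-1] * expR (- x^-1) else 0.

Lemma is_derive_flat p x :
  is_derive x 1 (flat p) (flat ((p - p^`()) * 'X^2) x).
Proof.
have [x0|x0|<-] := ltgtP 0 x.
- apply: (@is_derive_eq_itv _ _ (fun y => p.[y^-1] * expR (- y^-1)) 0 (x + 1)).
  + by rewrite x0 ltrDl ltr01.
  + by move=> y /andP[y0 _]; rewrite /flat y0.
  have dV : is_derive x 1 (fun y : R => y^-1) (- x ^- 2 *: 1).
    by apply: is_deriveV; rewrite ?gt_eqF //; exact: is_derive_id.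
  have dN : is_derive x 1 (fun y : R => - y^-1) (- (- x ^- 2 *: 1)).
    exact: is_deriveN dV.
  have dE := @is_derive1_comp _ expR _ x _ _ (is_derive_expR (- x^-1)) dN.
  have dP := @is_derive1_comp _ (horner p) _ x _ _ (is_derive_poly p x^-1) dV.
  apply: (is_derive_eq (is_deriveM dP dE)).
  rewrite /flat x0 /GRing.scale /= hornerM hornerXn hornerD hornerN exprVn.
  by ring.
- apply: (@is_derive_eq_itv _ _ (fun=> 0) (x - 1) 0).
  + by rewrite x0 gtrDl ltrN10.
  + by move=> y /andP[_ y0]; rewrite /flat ltNge ltW.
  by rewrite /flat ltNge (ltW x0) /=; exact: is_derive_cst.
(* At 0 the increment has to be o(y). The extra factor ['X^2], evaluated at [1 / y], buys a factor
   [y^2]: the increment is at most [C y^2]. *)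
have [C C0 HC] := horner_expRN_bounded (p * 'X^2).
rewrite /flat ltxx; apply/is_deriveP => e e0.
have C1 : 0 < C + 1 by rewrite ltr_wpDl.
exists (e / (C + 1)); first exact: divr_gt0.
move=> y; rewrite subr0 ltxx subr0 mul0r subr0; case: ifPn => [y0|_]; last first.
  by move=> _; rewrite normr0 mulr_ge0 // ltW.
rewrite ltr_pdivlMr // (gtr0_norm y0) => yC.
have := HC y^-1; rewrite invr_ge0 (ltW y0) => /(_ isT) => H.
rewrite normrM (ger0_norm (expR_ge0 _)).
have -> : `|p.[y^-1]| * expR (- y^-1) =
    `|(p * 'X^2).[y^-1]| * expR (- y^-1) * y * y.
  rewrite hornerM hornerXn normrM (ger0_norm (x := _ ^+ 2)) ?exprn_ge0 ?invr_ge0 ?ltW //.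
  by field; rewrite gt_eqF.
have y0' := ltW y0.
rewrite ler_wpM2r // (le_trans _ (ltW yC)) // [leRHS]mulrC ler_wpM2r //.
by rewrite (le_trans H) // lerDl.
Qed.

Lemma classC_flat p k : classC k (flat p).
Proof.
elim: k p => [|k IH] p; last exact: (classC_is_derive (is_derive_flat p)).
apply/classC0 => x; apply: differentiable_continuous.
by apply/derivable1_diffP; case: (is_derive_flat p x).
Qed.

Lemma flat_gt0 x : (0 < flat 1 x) = (0 < x).
Proof.
by rewrite /flat; case: ifPn => x0; rewrite ?ltxx // hornerC mul1r expR_gt0.
Qed.

Lemma flat_ge0 x : 0 <= flat 1 x.
Proof.
by rewrite /flat; case: ifPn => x0 //; rewrite hornerC mul1r expR_ge0.
Qed.

Lemma flat_le0 x : x <= 0 -> flat 1 x = 0.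
Proof. by rewrite /flat ltNge => ->. Qed.

(** The transition takes place in [[- e, 0]], to the left of the jump. As [e] tends to 0 the limit
    is the step equal to 1 at 0, which agrees at every point with the half-open cells used by
    [csp]. *)
Definition smooth_step e x : R :=
  flat 1 (x + e) / (flat 1 (x + e) + flat 1 (- x)).

Lemma smooth_step_den e x : 0 < e -> 0 < flat 1 (x + e) + flat 1 (- x).
Proof.
move=> e0; have [x0|x0] := ltP x 0.
  by rewrite ltr_wpDl ?flat_ge0 // flat_gt0 oppr_gt0.
by rewrite ltr_wpDr ?flat_ge0 // flat_gt0; lra.
Qed.

Lemma classC_smooth_step e k : 0 < e -> classC k (smooth_step e).
Proof.
move=> e0; have C1 : classC k (fun x => flat 1 (x + e)).
  have -> : (fun x => flat 1 (x + e)) = fun x => flat 1 (1 * x + e).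
    by apply/funext => x; rewrite mul1r.
  by apply: classC_affine; exact: classC_flat.
have C2 : classC k (fun x => flat 1 (- x)).
  have -> : (fun x => flat 1 (- x)) = fun x => flat 1 (-1 * x + 0).
    by apply/funext => x; rewrite mulN1r addr0.
  by apply: classC_affine; exact: classC_flat.
apply: classCM => //; apply: classCV; last exact: classCD.
by move=> x; rewrite gt_eqF // smooth_step_den.
Qed.

Lemma smooth_step1 e x : 0 < e -> 0 <= x -> smooth_step e x = 1.
Proof.
move=> e0 x0; have := smooth_step_den x e0; rewrite /smooth_step.
by rewrite (@flat_le0 (- x)) ?oppr_le0 // addr0 => /gt_eqF /negbT /divff.
Qed.

Lemma smooth_step0 e x : x <= - e -> smooth_step e x = 0.
Proof. by move=> xe; rewrite /smooth_step flat_le0 ?mul0r //; lra. Qed.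

Lemma smooth_step_ge0 e x : 0 < e -> 0 <= smooth_step e x.
Proof. by move=> e0; rewrite divr_ge0 ?flat_ge0 // ltW // smooth_step_den. Qed.

Lemma smooth_step_le1 e x : 0 < e -> smooth_step e x <= 1.
Proof.
by move=> e0; rewrite ler_pdivrMr ?smooth_step_den // mul1r lerDl flat_ge0.
Qed.

End smooth_step.

(** * Cardinal splines *)

Section cardinal_splines.
Context {R : realType}.
Implicit Types (c e : int -> R) (n k N : nat) (i : int) (p : {poly R}) (x : R).

(* The spline on the unit grid with B-spline coefficients [c], where [c j] is the
   coefficient of the B-spline supported in [[j, j + n + 1]]. *)
Definition csp n c x : R := (spiece n c (Num.floor x)).[x - (Num.floor x)%:~R].

Lemma csp_cell n c i x : i%:~R <= x < i%:~R + 1 ->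
  csp n c x = (spiece n c i).[x - i%:~R].
Proof.
by move=> ix; rewrite /csp (@floor_def _ x i) // intrD.
Qed.

Lemma csp_cellc n c i x : i%:~R <= x <= i%:~R + 1 ->
  csp n.+1 c x = (spiece n.+1 c i).[x - i%:~R].
Proof.
move=> /andP[ix]; rewrite le_eqVlt => /predU1P[->|xi]; last first.
  by rewrite (@csp_cell _ _ i) // ix.
rewrite (@csp_cell _ _ (i + 1)); last by rewrite intrD lexx ltrDl ltr01.
by rewrite intrD subrr addrAC subrr add0r spiece_glue.
Qed.

Lemma is_derive_poly_shift p (b x : R) :
  is_derive x 1 (fun y => p.[y - b]) p^`().[x - b].
Proof.
rewrite -[X in is_derive x 1 _ X]mulr1.
rewrite (_ : (fun y => _) = fun y => p.[1 * y + - b]); last first.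
  by apply/funext => y; rewrite mul1r.
by apply: is_derive_affine; rewrite mul1r; exact: is_derive_poly.
Qed.

Lemma continuous_poly_shift p (b : R) : continuous (fun y => p.[y - b]).
Proof.
move=> x; apply: differentiable_continuous; apply/derivable1_diffP.
by case: (is_derive_poly_shift p b x).
Qed.

Lemma continuous_glue (f P Q : R -> R) (x r : R) : 0 < r ->
  {for x, continuous P} -> {for x, continuous Q} ->
  (forall y, x - r < y <= x -> f y = P y) ->
  (forall y, x <= y < x + r -> f y = Q y) -> {for x, continuous f}.
Proof.
move=> r0 /cvgrPdist_lt cP /cvgrPdist_lt cQ fP fQ; apply/cvgrPdist_lt => e e0.
near=> y; have yr : `|y - x| < r.
  by near: y; exists r => //= z; rewrite /= distrC.
have /ltr_normlP[yr1 yr2] := yr.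
have [yx|xy] := leP y x.
  rewrite (fP x) ?(fP y); [near: y; exact: cP|lra|lra].
rewrite (fQ x) ?(fQ y); [near: y; exact: cQ|lra|lra].
Unshelve. all: by end_near. Qed.

Lemma continuous_eq_itvcc (f g : R -> R) (a b : R) : a < b ->
  continuous f -> continuous g -> (forall x, a < x < b -> f x = g x) ->
  forall x, a <= x <= b -> f x = g x.
Proof.
move=> ab cf cg fg x /andP[ax xb]; apply/eqP; rewrite -subr_eq0.
apply/negPn/negP => h0; have hx : 0 < `|f x - g x| by rewrite normr_gt0.
have /cvgrPdist_lt /(_ _ hx) [r /= r0 Hr] :
    (f y - g y) @[y --> x] --> (f x - g x) by apply: cvgB; [exact: cf|exact: cg].
(* Moving [x] by the fraction [t] of the way to the midpoint lands in the open interval, at distance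
   less than [r] from [x]. *)
pose t := Num.min 1 (r / (b - a)).
have ba0 : 0 < b - a by rewrite subr_gt0.
have t0 : 0 < t by rewrite lt_min ltr01 divr_gt0.
have t1 : t <= 1 by rewrite ge_min lexx.
have tr : t * (b - a) <= r.
  by rewrite -ler_pdivlMr // ge_min lexx orbT.
have mx : `|(a + b) / 2 - x| < b - a by apply/ltr_normlP; split; lra.
have := Hr (x + t * ((a + b) / 2 - x)) => /=.
rewrite opprD addNKr normrN normrM (gtr0_norm t0).
have -> : t * `|(a + b) / 2 - x| < r.
  by rewrite (lt_le_trans _ tr) // ltr_pM2l.
rewrite (fg (x + _)) ?subrr ?subr0 ?ltxx; first by move=> /(_ isT).
have P1 : 0 <= (1 - t) * (x - a) by rewrite mulr_ge0 ?subr_ge0.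
have P2 : 0 <= (1 - t) * (b - x) by rewrite mulr_ge0 ?subr_ge0.
have P3 : 0 < t * (b - a) by rewrite mulr_gt0.
by apply/andP; split; lra.
Qed.

(** The cells to the left and to the right of [x]: they are the same unless [x] is a knot. The left
    one is closed because a knot [x] is its right end, where [csp_cellc] still applies. *)
Lemma csp_near n c x : exists j i r, [/\ 0 < r,
  forall y, x - r < y <= x -> j%:~R <= y <= j%:~R + 1 &
  forall y, x <= y < x + r -> i%:~R <= y < i%:~R + 1].
Proof.
pose i := Num.floor x; have /andP[ix xi] := floor_itv x.
rewrite intrD -/i in ix xi; exists (if x == i%:~R then i - 1 else i), i.
case: eqVneq => [xE|xNi].
  exists 1; rewrite ltr01 -xE; split=> // y; rewrite ?intrB -?xE; lra.
have {}ix : i%:~R < x by rewrite lt_neqAle eq_sym xNi.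
exists (Num.min (x - i%:~R) (i%:~R + 1 - x)); split=> [|y|y].
- by rewrite lt_min !subr_gt0 ix.
- rewrite ltrBlDl -ltrBlDr lt_min => /andP[/andP[y1 y2] yx]; lra.
- rewrite -ltrBlDl lt_min => /andP[xy /andP[y1 y2]]; lra.
Qed.

Lemma continuous_csp n c : continuous (csp n.+1 c).
Proof.
move=> x; have [j [i [r [r0 Hj Hi]]]] := csp_near n c x.
apply: (continuous_glue r0 (@continuous_poly_shift (spiece n.+1 c j) j%:~R x)
  (@continuous_poly_shift (spiece n.+1 c i) i%:~R x)) => y /[dup] yx.
  by move/Hj => /csp_cellc.
by move/Hi => /csp_cell.
Qed.

Lemma is_derive_csp n c x : is_derive x 1 (csp n.+2 c) (csp n.+1 (nabla c) x).
Proof.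
have [j [i [r [r0 Hj Hi]]]] := csp_near n c x.
have Dj := is_derive_poly_shift (spiece n.+2 c j) j%:~R x.
have Di := is_derive_poly_shift (spiece n.+2 c i) i%:~R x.
rewrite deriv_spiece in Dj; rewrite deriv_spiece in Di.
rewrite -csp_cellc in Dj; last by apply: Hj; rewrite lexx gtrBl r0.
rewrite -csp_cell in Di; last by apply: Hi; rewrite lexx ltrDl r0.
apply: (is_derive_glue r0 Dj Di) => y.
  by move/Hj => /csp_cellc.
by move/Hi => /csp_cell.
Qed.

Lemma classC_csp n c : classC n (csp n.+1 c).
Proof.
elim: n c => [|n IH] c; first by apply/classC0; exact: continuous_csp.
exact: classC_is_derive (is_derive_csp n c) (IH _).
Qed.

Lemma csp_cst n a x : csp n (fun=> a) x = a.
Proof. by rewrite /csp spiece_cst hornerC. Qed.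

Lemma cspD n c e x : csp n (fun i => c i + e i) x = csp n c x + csp n e x.
Proof. by rewrite /csp spieceD hornerD. Qed.

Lemma csp_shift n c m x : csp n (fun j => c (j + m)) x = csp n c (x + m%:~R).
Proof.
have /andP[fx xf] := floor_itv x.
rewrite (@csp_cell _ c (Num.floor x + m)).
  by rewrite {1}/csp spiece_shift intrD; congr (_.[_]); ring.
by move: fx xf; rewrite !intrD; lra.
Qed.

Lemma csp_inj n c e : (forall x, csp n c x = csp n e x) -> c = e.
Proof.
move=> ce; apply/funext => i; apply/eqP; rewrite -subr_eq0; apply/eqP.
have H : spiece n c i = spiece n e i.
  apply: poly_eq01 => t /andP[t0 t1].
  have := ce (t + i%:~R); rewrite !(@csp_cell _ _ i) ?addrK //; lra.
have H0 : spiece n (fun j => c j - e j) i = 0 by rewrite spieceB H subrr.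
have := @bpiece_free R n (fun k => c (i - k%:Z) - e (i - k%:Z)) H0 0%N (leq0n n).
by rewrite subr0.
Qed.

Lemma nabla_surj d : exists c, nabla c = d :> (int -> R).
Proof.
exists (fun i => match i with
  | Posz n => \sum_(k < n) d k.+1%:Z
  | Negz n => - \sum_(k < n.+1) d (- k%:Z) end).
apply/funext => -[[|n]|n]; rewrite /nabla.
- by rewrite /= big_ord0 big_ord1 sub0r opprK.
- rewrite (_ : Posz n.+1 - 1 = Posz n); last by lia.
  by rewrite big_ord_recr /= addrAC subrr add0r.
- rewrite (_ : Negz n - 1 = Negz n.+1); last by rewrite !NegzE; lia.
  by rewrite [in X in _ - X]big_ord_recr /= opprK addKr NegzE.
Qed.

(** Induction on the degree: the derivative of [V] has coefficients [d] by induction, and a discrete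
    primitive [c] of [d] gives a spline with the same derivative as [V]. The remaining constant is
    absorbed into the coefficients by the partition of unity. *)
Lemma csp_surj n (V : R -> R) : classC n V ->
  (forall i, exists2 q : {poly R}, (size q <= n.+2)%N &
     forall x, i%:~R < x < i%:~R + 1 -> V x = q.[x]) ->
  exists c, V = csp n.+1 c.
Proof.
elim: n V => [|n IH] V CV HV.
  (* The hat function of index [i] is supported in [[i, i + 2]] and peaks at [i + 1], so in degree 1
     the coefficients are nodal values. *)
  exists (fun i => V (i + 1)%:~R); apply/funext => x.
  have cV := (classC0 _).1 CV.
  pose i := Num.floor x; have /andP[ix xi] := floor_itv x.
  have [q sq Vq] := HV i.
  have Vqc y : i%:~R <= y <= i%:~R + 1 -> V y = q.[y].
    move: y; apply: (@continuous_eq_itvcc V (horner q)) => //.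
      by rewrite ltrDl ltr01.
    exact: continuous_horner.
  have ixx : i%:~R <= x <= i%:~R + 1 by rewrite ix ltW // -intrD1.
  rewrite (csp_cellc _ _ ixx) /spiece big_ord_recr big_ord1 /=.
  have qE y : q.[y] = q`_0 + q`_1 * y.
    rewrite (horner_coef_wide _ sq) !big_ord_recr big_ord0 /=.
    by rewrite add0r expr0 mulr1 expr1.
  rewrite mulr1n mulr0n pint0 pint1 subr0 subrK intrD1 add0r addr0.
  rewrite hornerD !hornerZ hornerD hornerN hornerC !hornerX.
  rewrite !Vqc ?qE ?lexx ?lerDl ?ler01 //; ring.
have [d Vd] : exists d, derive1 V = csp n.+1 d.
  apply: IH; first exact: classCS_derive1.
  move=> i; have [q sq Vq] := HV i; exists q^`().
    have [->|q0] := eqVneq q 0; first by rewrite deriv0 size_poly0.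
    by rewrite -ltnS (leq_trans (lt_size_deriv q0)).
  move=> x ix; have : is_derive x 1 V (q^`().[x]).
    exact: is_derive_eq_itv ix Vq (is_derive_poly q x).
  by case=> _ <-; rewrite derive1E.
have [c cd] := nabla_surj d.
have D0 (x : R) : is_derive x 1 (fun y => V y - csp n.+2 c y) 0.
  have := is_deriveB (classCS_is_derive x CV) (is_derive_csp n c x).
  by rewrite Vd cd subrr.
exists (fun i => c i + (V 0 - csp n.+2 c 0)); apply/funext => x.
rewrite cspD csp_cst -(is_derive_0_is_cst x 0 D0); ring.
Qed.

(** * Periodic splines on the grid of mesh [1 / N] as periodic coefficient sequences *)

Lemma csp_periodic n c N x : periodic c N%:Z -> csp n c (x + N%:R) = csp n c x.
Proof.
move=> cN; rewrite -[N%:R]/(N%:Z%:~R) -csp_shift; congr csp.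
by apply/funext => i.
Qed.

Lemma size_comp_affine m p (a b : R) :
  (size p <= m.+1)%N -> (size (p \Po (a *: 'X - b%:P)) <= m.+1)%N.
Proof.
move=> pm; apply: leq_trans (size_comp_poly_leq _ _) _.
have s2 : (size (a *: 'X - b%:P)%R <= 2)%N.
  rewrite (leq_trans (size_polyD _ _)) // geq_max size_polyN.
  rewrite (leq_trans (size_scale_leq _ _)) ?size_polyX //=.
  by rewrite (leq_trans (size_polyC_leq1 _)).
by rewrite ltnS -[m]muln1 leq_mul //; lia.
Qed.

Lemma spline_csp n N c : (0 < N)%N -> periodic c N%:Z ->
  spline n.+2 N (fun x => csp n.+1 c (N%:R * x)).
Proof.
move=> N0 cN; have N0' : 0 < N%:R :> R by rewrite ltr0n.
split.
- by move=> x; rewrite mulrDr mulr1 csp_periodic.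
- rewrite subn2 /= (_ : (fun x => _) = fun x => csp n.+1 c (N%:R * x + 0)).
    by apply: classC_affine; exact: classC_csp.
  by apply/funext => x; rewrite addr0.
move=> [|i] // _; exists (spiece n.+1 c i%:Z \Po (N%:R *: 'X - i%:R%:P)).
  exact/size_comp_affine/size_spiece.
move=> x; rewrite /node /= => /andP[]; rewrite ltr_pdivrMr // ltr_pdivlMr //.
rewrite (mulrC x) -addn1 natrD => ix xi.
by rewrite (@csp_cell _ _ i%:Z) ?(ltW ix) // horner_comp !hornerE.
Qed.

(** Polynomial pieces are given on one period only; those of the other cells come from reducing the
    index modulo [N]. Periodicity of the coefficients follows from their uniqueness. *)
Lemma spline_csp_ex n N (v : R -> R) : (0 < N)%N -> spline n.+2 N v ->
  exists2 c, periodic c N%:Z & v = fun x => csp n.+1 c (N%:R * x).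
Proof.
move=> N0 [v1 Cv Hv]; have N0' : N%:R != 0 :> R by rewrite pnatr_eq0 -lt0n.
pose V x := v (N%:R^-1 * x + 0).
have vn (m : nat) x : v (x + m%:R) = v x by exact: periodicn.
have vz (m : int) x : v (x + m%:~R) = v x.
  case: m => m; first exact: vn.
  by rewrite NegzE mulrNz -(vn m.+1) -pmulrn subrK.
have VN x : V (x + N%:R) = V x by rewrite /V !addr0 mulrDr mulVf.
have [c Vc] : exists c, V = csp n.+1 c.
  apply: csp_surj; first by rewrite subn2 in Cv; exact: classC_affine.
  move=> i; pose j := `|(i %% N)%Z|%N; pose m := (i %/ N)%Z.
  have NZ : N%:Z != 0 by rewrite -lt0n in N0 *.
  have iE : i = j%:Z + m * N%:Z.
    by rewrite /j gez0_abs ?modz_ge0 // addrC -divz_eq.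
  have jN : (j < N)%N by rewrite -ltz_nat gez0_abs ?modz_ge0 // ltz_pmod.
  have [q sq vq] := Hv j.+1 jN.
  exists (q \Po (N%:R^-1 *: 'X - m%:~R%:P)).
    exact: size_comp_affine.
  move=> x; rewrite iE intrD intrM => /andP[ix xi].
  rewrite horner_comp !hornerE -vq; last first.
    have N0'' : 0 < N%:R :> R by rewrite ltr0n.
    rewrite /node /= ltr_pdivrMr // ltr_pdivlMr // mulrBl mulrAC mulVf // mul1r.
    by rewrite -addn1 natrD; move: ix xi; rewrite -pmulrn; lra.
  by rewrite /V addr0 -[RHS](vz m) subrK.
exists c.
  move=> i; have : (fun j => c (j + N%:Z)) = c.
    by apply: (@csp_inj n.+1) => x; rewrite csp_shift -Vc; exact: VN.
  by move/(congr1 (@^~ i)).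
by apply/funext => x; rewrite -Vc /V addr0 mulKf.
Qed.

End cardinal_splines.

(** * Integration on the line *)

Section integrals.
Context {R : realType}.
Implicit Types (f g h F : R -> R) (a b c x M : R).
Local Notation mu := (@lebesgue_measure R).

Lemma locally_integrable_itv f a b : locally_integrable setT f ->
  mu.-integrable `[a, b] (EFin \o f).
Proof.
move=> [mf _ H]; apply/integrableP; split; last first.
  by apply: H => //; exact: segment_compact.
by apply/measurable_EFinP; exact: measurable_funS mf.
Qed.

Lemma continuous_itv_integrable f a b : continuous f ->
  mu.-integrable `[a, b] (EFin \o f).
Proof.
move=> cf; apply: continuous_compact_integrable; first exact: segment_compact.
exact: continuous_subspaceT.
Qed.

Lemma itv_integrableZ f a b k : mu.-integrable `[a, b] (EFin \o f) ->
  mu.-integrable `[a, b] (EFin \o (fun x => k * f x)).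
Proof.
move=> fi; have mD : measurable (`[a, b]%classic : set (measurableTypeR R)).
  exact: measurable_itv.
exact: (integrableZl mD k fi).
Qed.

Lemma integrable_mul_bounded (D : set (measurableTypeR R)) f h M : measurable D ->
  mu.-integrable D (EFin \o f) ->
  measurable_fun D h -> (forall x, D x -> `|h x| <= M) ->
  mu.-integrable D (EFin \o (fun x => f x * h x)).
Proof.
move=> mD fi mh hM; apply: (@integrableMl _ _ _ mu D mD (EFin \o f) h) => //.
exists M; split; first exact: num_real.
by move=> M' MM' x /hM /le_trans; apply; exact: ltW.
Qed.

Lemma continuous_FTC F f a b : a <= b -> continuous f ->
  (forall x, is_derive x 1 F (f x)) ->
  \int[mu]_(x in `[a, b]) f x = F b - F a.
Proof.
rewrite le_eqVlt => /predU1P[->|ab] cf dF.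
  by rewrite set_itv1 Rintegral_set1 subrr.
have cF : continuous F.
  move=> x; apply: differentiable_continuous; apply/derivable1_diffP.
  by case: (dF x).
rewrite /Rintegral (@continuous_FTC2 _ f F) //.
- exact: continuous_subspaceT.
- split; first by move=> x _; case: (dF x).
    exact: cvg_at_right_filter (cF a).
  exact: cvg_at_left_filter (cF b).
- by move=> x _; rewrite derive1E; case: (dF x).
Qed.

Lemma Rintegral_split f a c b : a <= c <= b ->
  mu.-integrable `[a, b] (EFin \o f) ->
  \int[mu]_(x in `[a, b]) f x =
  \int[mu]_(x in `[a, c]) f x + \int[mu]_(x in `[c, b]) f x.
Proof.
move=> /andP[ac cb] fi.
have := @Rintegral_itvB R f (BLeft a) (BRight b) c fi.
rewrite !bnd_simp ac cb => /(_ isT isT) H.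
have <- := @Rintegral_itv_obnd_cbnd R c (BRight b) f.
  by rewrite -H addrC subrK.
by apply: integrableS fi => //; apply: subset_itv; rewrite ?bnd_simp.
Qed.

Lemma Rintegral_support f (D : set R) : (forall x, ~ D x -> f x = 0) ->
  \int[mu]_x f x = \int[mu]_(x in D) f x.
Proof.
move=> f0; rewrite [RHS]Rintegral_mkcond; apply: eq_Rintegral => x _.
rewrite patchE; case: ifPn => // /negP xD.
by rewrite f0 // => Dx; apply: xD; rewrite inE.
Qed.

Lemma Rintegral_dominated_cvg (D : set (measurableTypeR R)) (f_ : nat -> R -> R) f g :
  measurable D -> (forall n, measurable_fun D (f_ n)) ->
  (forall x, D x -> f_ ^~ x @ \oo --> f x) ->
  mu.-integrable D (EFin \o g) ->
  (forall n x, D x -> `|f_ n x| <= g x) ->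
  mu.-integrable D (EFin \o f) /\
  \int[mu]_(x in D) f_ n x @[n --> \oo] --> \int[mu]_(x in D) f x.
Proof.
move=> mD mf_ f_f ig f_g.
have mf : measurable_fun D (EFin \o f).
  by apply/measurable_EFinP; exact: measurable_fun_cvg f_f.
have H := @dominated_convergence _ _ _ mu D mD (fun n => EFin \o f_ n)
  (EFin \o f) (EFin \o g).
have [] := H.
- by move=> n; apply/measurable_EFinP; exact: mf_.
- exact: mf.
- by apply: aeW => x Dx; apply: cvg_EFin; [exact: nearW|exact: f_f].
- exact: ig.
- by apply: aeW => x n Dx /=; rewrite lee_fin f_g.
move=> fi _ cv; split => //.
apply: fine_cvg; rewrite fineK //; exact: integrable_fin_num.
Qed.

Lemma Rintegral_sum (D : set (measurableTypeR R)) (I : Type) (s : seq I) (k : I -> R)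
    (f : I -> R -> R) : measurable D ->
  (forall i, mu.-integrable D (EFin \o f i)) ->
  mu.-integrable D (EFin \o (fun x => \sum_(i <- s) k i * f i x)) /\
  \int[mu]_(x in D) (\sum_(i <- s) k i * f i x) =
  \sum_(i <- s) k i * \int[mu]_(x in D) f i x.
Proof.
move=> mD fi; elim: s => [|i s [IHi IH]].
  have -> : (fun x => \sum_(i <- [::]) k i * f i x) = fun=> 0.
    by apply/funext => x; rewrite big_nil.
  by rewrite big_nil Rintegral_cst // mul0r; split => //; exact: integrable0.
have kfi : mu.-integrable D (EFin \o (fun x => k i * f i x)).
  exact: (integrableZl mD (k i) (fi i)).
have -> : (fun x => \sum_(i <- i :: s) k i * f i x) =
    fun x => k i * f i x + \sum_(i <- s) k i * f i x.
  by apply/funext => x; rewrite big_cons.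
rewrite big_cons RintegralD // RintegralZl // IH; split => //.
exact: (integrableD mD kfi IHi).
Qed.

Lemma preimage_translate_itv (c : R) (bl br : bool) a b :
  (fun x => x + c) @^-1` [set` Interval (BSide bl a) (BSide br b)] =
  [set` Interval (BSide bl (a - c)) (BSide br (b - c))].
Proof.
apply/seteqP; split=> x /=; rewrite !in_itv /=;
  by case: bl; case: br; rewrite /= ?lerBlDr ?ltrBlDr ?lerBrDr ?ltrBrDr.
Qed.

(** By uniqueness of Lebesgue measure it is enough to compare lengths of intervals. *)
Lemma lebesgue_measure_translate c (A : set R) : measurable A ->
  pushforward mu ((fun x => x + c) : _ -> measurableTypeR R) A = mu A.
Proof.
move=> mA; apply/esym/lebesgue_measure_unique => //=.
  have : measurable_fun setT (fun x : R => x + c) by exact: measurable_funD.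
  by [].
move=> H _ [[a b]] _ <-.
rewrite /pushforward preimage_translate_itv /= !lebesgue_measure_itv /=.
have -> : (b%:E - a%:E = (b - c)%:E - (a - c)%:E)%E.
  by rewrite -!EFinB; congr EFin; ring.
by rewrite !lte_fin ltrD2r.
Qed.

Lemma Rintegral_translate f a b c : measurable_fun setT f ->
  mu.-integrable `[a, b] (EFin \o (fun x => f (x + c))) ->
  \int[mu]_(x in `[a, b]) f (x + c) = \int[mu]_(x in `[a + c, b + c]) f x.
Proof.
move=> mf fi; have E : `[a, b]%classic =
    ((fun x => x + c) : _ -> measurableTypeR R) @^-1` `[a + c, b + c].
  by rewrite preimage_translate_itv !addrK.
rewrite /Rintegral; congr fine; rewrite E in fi *.
have mphi : measurable_fun setT
    ((fun x => x + c) : measurableTypeR R -> measurableTypeR R).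
  have : measurable_fun setT (fun x : R => x + c) by exact: measurable_funD.
  by [].
have mf' : measurable_fun setT (EFin \o f : measurableTypeR R -> _).
  by apply/measurable_EFinP.
have H := @integral_pushforward _ _ _ _ _ _ mphi mu `[a + c, b + c]
  (EFin \o f) mf' fi.
rewrite -(H (measurable_itv _)).
by apply: eq_measure_integral => //= A mA AS; exact: lebesgue_measure_translate.
Qed.

End integrals.

(** * Mollified B-splines *)

Section mollified_splines.
Context {R : realType}.
Implicit Types (f g h F : R -> R) (a b x M eps : R) (c e : int -> R) (n l k N : nat).
Local Notation mu := (@lebesgue_measure R).

(** Convolution with the indicator of the unit interval: it raises the degree of a cardinal spline
    by one, and its derivative is the backward difference [dif]. *)
Definition avg f x : R := \int[mu]_(t in `[x - 1, x]) f t.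

Definition dif f x : R := f x - f (x - 1).

Lemma is_derive_avg f x : continuous f -> is_derive x 1 (avg f) (dif f x).
Proof.
(* The fixed base point [x - 3] lies to the left of [y - 1] for every [y] within distance 1 of
   [x]. *)
move=> cf; pose F y := \int[mu]_(t in `[x - 3, y]) f t.
have dF y : x - 3 < y -> is_derive y 1 F (f y).
  move=> xy; have yy : y < y + 1 by rewrite ltrDl.
  have [dF <-] := continuous_FTC1_closed yy
    (continuous_itv_integrable (x - 3) (y + 1) cf) xy (cf y).
  exact: derive1_is_derive.
apply: (@is_derive_eq_itv _ _ (fun y => F y - F (1 * y + -1)) (x - 1) (x + 1)).
- lra.
- move=> y /andP[y1 y2]; rewrite /F mul1r (@Rintegral_split _ f _ (y - 1)).
  + by rewrite addrC addKr.
  + by apply/andP; split; lra.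
  + exact: continuous_itv_integrable.
- apply: is_deriveB; first by apply: dF; lra.
  rewrite -[f (x - 1)]mulr1; apply: is_derive_affine; rewrite mul1r.
  by apply: dF; lra.
Qed.

Lemma csp_nabla n c : csp n (nabla c) = dif (csp n c).
Proof.
apply/funext => x; rewrite /dif -[x - 1]/(x + (-1)%:~R) -csp_shift.
rewrite /csp -hornerN -hornerD -spieceB; congr (_.[_]).
Qed.

Lemma csp_iter_nabla n l c : csp n (iter l nabla c) = iter l dif (csp n c).
Proof. by elim: l => //= l IH; rewrite csp_nabla IH. Qed.

(** In positive degree, [c] is written as [nabla d]; the integrand is then the derivative of the
    spline with coefficients [d], whose increment over [[x - 1, x]] is again a difference of
    coefficients. Degree 0 has no such primitive among the differentiable splines and is computed by
    hand. *)
Lemma avg_csp n c : avg (csp n c) = csp n.+1 c.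
Proof.
apply/funext => x; rewrite /avg; case: n => [|n]; last first.
  have [d <-] := nabla_surj c.
  have x1 : x - 1 <= x by rewrite gerBl.
  by rewrite (continuous_FTC x1 (@continuous_csp R n _) (is_derive_csp n d))
    csp_nabla.
pose i := Num.floor x; have /andP[ix xi] := floor_itv x.
rewrite intrD1 -/i in ix xi.
have cst0 j y : j%:~R <= y < j%:~R + 1 -> csp 0 c y = c j.
  move=> /csp_cell ->.
  by rewrite /spiece big_ord1 subr0 /= alg_polyC hornerC.
pose A : set (measurableTypeR R) := `[i%:~R, x]%classic.
have mA : measurable A by exact: measurable_itv.
have xx : x - 1 <= i%:~R by lra.
(* The window contains the knot [i]: the step function takes the value [c (i - 1)] before it and
   [c i] from it on. *)
have E y : y \in `[x - 1, x]%classic ->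
    csp 0 c y = c (i - 1) + (c i - c (i - 1)) * \1_A y.
  rewrite inE /= in_itv /= => /andP[y1 y2]; rewrite indicE.
  have [iy|yi] := leP i%:~R y.
    have -> : y \in A by rewrite inE /A /= in_itv /= iy y2.
    by rewrite mulr1 subrKC; apply: cst0; lra.
  have -> : (y \in A) = false.
    by apply/negP; rewrite inE /A /= in_itv /= leNgt yi.
  by rewrite mulr0 addr0; apply: cst0; rewrite intrB; lra.
have i1 : mu.-integrable `[x - 1, x] (EFin \o cst (c (i - 1))).
  by apply: continuous_itv_integrable; exact: cst_continuous.
have i2 : mu.-integrable `[x - 1, x] (EFin \o \1_A).
  by apply: (@integrableS _ _ _ mu setT) => //; exact: integrable_indic_itv.
have i3 : mu.-integrable `[x - 1, x]
    (EFin \o (fun y => (c i - c (i - 1)) * \1_A y)).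
  exact: itv_integrableZ i2.
have -> : \int[mu]_(y in `[x - 1, x]) csp 0 c y =
    \int[mu]_(y in `[x - 1, x]) (c (i - 1) + (c i - c (i - 1)) * \1_A y).
  exact: eq_Rintegral.
rewrite RintegralD // RintegralZl // Rintegral_cst //.
have -> : \int[mu]_(y in `[x - 1, x]) \1_A y = x - i%:~R.
  rewrite /Rintegral integral_indic // setIidl; last first.
    by apply: subset_itv; rewrite bnd_simp.
  rewrite /A /= lebesgue_measure_itv /= lte_fin; case: ltP => [//|xi'] /=.
  by apply/eqP; rewrite eq_sym subr_eq0; apply/eqP; lra.
rewrite /= lebesgue_measure_itv /= lte_fin gtrBl ltr01 /=.
rewrite (@csp_cell _ _ _ i) ?ix // /spiece big_ord_recr big_ord1 /=.
rewrite mulr1n mulr0n pint0 pint1 subr0 addr0 add0r.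
rewrite hornerD !hornerZ hornerD hornerN hornerC !hornerX; ring.
Qed.

(* The B-spline of degree [n] with a smoothed initial step: a smooth compactly
   supported function, all of whose derivatives are differences of B-splines of
   the same kind by the fundamental theorem of calculus alone. *)
Fixpoint mbspline eps n : R -> R :=
  if n is n'.+1 then avg (mbspline eps n') else dif (smooth_step eps).

Lemma is_derive_mbspline eps n x : 0 < eps ->
  is_derive x 1 (mbspline eps n.+1) (dif (mbspline eps n) x).
Proof.
move=> e0; apply: is_derive_avg; elim: n => [|n IH].
  move=> y; apply: (@classC_continuous R 0).
  apply: classCB; first exact: classC_smooth_step.
  rewrite (_ : (fun x => _) = fun x => smooth_step eps (1 * x + -1)).
    by apply: classC_affine; exact: classC_smooth_step.
  by apply/funext => z; rewrite mul1r.
move=> y; apply: differentiable_continuous; apply/derivable1_diffP.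
by case: (is_derive_avg y IH).
Qed.

Lemma classC_dif m f : classC m f -> classC m (dif f).
Proof.
move=> Cf; apply: classCB => //.
rewrite (_ : (fun x => _) = fun x => f (1 * x + -1)).
  exact: classC_affine.
by apply/funext => z; rewrite mul1r.
Qed.

Lemma classC_mbspline eps n m : 0 < eps -> classC m (mbspline eps n).
Proof.
move=> e0; elim: n m => [|n IH] m.
  by apply: classC_dif; exact: classC_smooth_step.
apply: (@classCW _ m); apply: (classC_is_derive (df := dif (mbspline eps n))).
  by move=> x; exact: is_derive_mbspline.
exact: classC_dif.
Qed.

Lemma mbspline_le1 eps n x : 0 < eps -> `|mbspline eps n x| <= 1.
Proof.
move=> e0; elim: n x => [|n IH] x /=.
  rewrite /dif ler_norml.
  have := smooth_step_ge0 x e0; have := smooth_step_le1 x e0.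
  have := smooth_step_ge0 (x - 1) e0; have := smooth_step_le1 (x - 1) e0.
  lra.
have cb : continuous (mbspline eps n).
  exact: (@classC_continuous _ 0 _ (classC_mbspline n 0 e0)).
have ib := continuous_itv_integrable (x - 1) x cb.
apply: le_trans (le_normr_Rintegral _ ib) _ => //.
apply: (@le_trans _ _ (\int[mu]_(t in `[x - 1, x]) 1)).
  apply: le_Rintegral => //.
  - by apply: continuous_itv_integrable => y; apply: cvg_norm; exact: cb.
  - by apply: continuous_itv_integrable; exact: cst_continuous.
rewrite Rintegral_cst // /= lebesgue_measure_itv /= lte_fin gtrBl ltr01 /=.
by rewrite mul1r opprB addrCA subrr addr0.
Qed.

Lemma mbspline_support eps n x : 0 < eps ->
  x <= - eps \/ n.+1%:R <= x -> mbspline eps n x = 0.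
Proof.
move=> e0; elim: n x => [|n IH] x H /=.
  rewrite /dif; case: H => H.
    by rewrite !smooth_step0 ?subrr //; lra.
  by rewrite !smooth_step1 ?subrr //; lra.
rewrite /avg (@eq_Rintegral _ _ _ mu _ (fun=> 0)) ?Rintegral_cst ?mul0r //.
move=> y; rewrite inE /= in_itv /= => /andP[y1 y2]; apply: IH.
case: H => H; first by left; lra.
by right; move: H; rewrite -[n.+2]addn1 natrD; lra.
Qed.

Lemma derive1n_dif l f : classC l f -> derive1n l (dif f) = dif (derive1n l f).
Proof.
elim: l f => [|l IH] f Cf //; rewrite /derive1n !iterSr -!/(derive1n _ _).
rewrite -IH; last exact: classCS_derive1.
congr derive1n; apply: is_derive_derive1 => x.
apply: is_deriveB; first exact: classCS_is_derive Cf.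
rewrite (_ : (fun x => _) = fun x => f (1 * x + -1)); last first.
  by apply/funext => z; rewrite mul1r.
rewrite -[derive1 f _]mulr1; apply: is_derive_affine; rewrite mul1r.
exact: classCS_is_derive Cf.
Qed.

Lemma derive1n_mbspline eps n l : 0 < eps ->
  derive1n l (mbspline eps (n + l)) = iter l dif (mbspline eps n).
Proof.
move=> e0; elim: l => [|l IH]; first by rewrite addn0.
rewrite /derive1n iterSr addnS -/(derive1n _ _).
rewrite (is_derive_derive1 (fun x => @is_derive_mbspline eps (n + l) x e0)).
by rewrite derive1n_dif ?IH //; exact: classC_mbspline.
Qed.

Lemma iter_dif_bound l f M : (forall x, `|f x| <= M) ->
  forall x, `|iter l dif f x| <= 2 ^+ l * M.
Proof.
move=> fM; elim: l => [|l IH] x; first by rewrite expr0 mul1r.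
rewrite iterS /dif (le_trans (ler_normB _ _)) // exprS -mulrA mulr_natl mulr2n.
by rewrite lerD.
Qed.

Lemma iter_dif_support l f a b : (forall x, x < a \/ b <= x -> f x = 0) ->
  forall x, x < a \/ b + l%:R <= x -> iter l dif f x = 0.
Proof.
move=> f0; elim: l => [|l IH] x H; first by apply: f0; rewrite addr0 in H.
rewrite iterS /dif !IH ?subrr //; move: H; rewrite -[l.+1]addn1 natrD;
  by case=> H; [left|right]; lra.
Qed.

Lemma iter_dif_cvg l (f_ : nat -> R -> R) f :
  (forall x, f_ m x @[m --> \oo] --> f x) ->
  forall x, iter l dif (f_ m) x @[m --> \oo] --> iter l dif f x.
Proof. by move=> ff; elim: l => // l IH x; apply: cvgB; exact: IH. Qed.

Definition delta (j i : int) : R := (i == j)%:R.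

(** The limit holds at every point: in degree 0 it is that of the smooth steps, and dominated
    convergence with the bound 1 carries it through each average. *)
Lemma mbspline_cvg n x :
  mbspline (m.+1%:R^-1) n x @[m --> \oo] --> csp n (delta 0) x.
Proof.
have e0 m : 0 < m.+1%:R^-1 :> R by rewrite invr_gt0.
elim: n x => [|n IH] x.
  pose H x : R := (0 <= x)%R%:R.
  have HE : csp 0 (delta 0) x = H x - H (x - 1).
    rewrite /csp /spiece big_ord1 subr0 /= alg_polyC hornerC /delta /H.
    have := floor_eq x 0; rewrite add0r => ->.
    rewrite subr_ge0; case: (leP 0 x) => x0; case: (ltP x 1) => x1 //=;
      rewrite ?subr0 ?subrr //; lra.
  have Hc y : smooth_step (m.+1%:R^-1) y @[m --> \oo] --> H y.
    rewrite /H; case: leP => y0.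
      by under eq_fun do rewrite smooth_step1 //; exact: cvg_cst.
    have Ny : 0 < - y by rewrite oppr_gt0.
    apply: cvg_near_cst; near=> m; apply: smooth_step0.
    rewrite lerNr; apply: ltW.
    by near: m; exact: (near_infty_natSinv_lt (PosNum Ny)).
  by rewrite HE; apply: cvgB; exact: Hc.
rewrite -avg_csp /= /avg.
refine (proj2 (@Rintegral_dominated_cvg R `[x - 1, x]
  (fun m => mbspline m.+1%:R^-1 n) (csp n (delta 0)) (fun=> 1) _ _ _ _ _)).
- exact: measurable_itv.
- move=> m; apply: measurable_funTS; apply: continuous_measurable_fun.
  exact: (@classC_continuous _ 0 _ (classC_mbspline n 0 (e0 m))).
- by move=> y _; exact: IH.
- by apply: continuous_itv_integrable; exact: cst_continuous.
- by move=> m y _; exact: mbspline_le1.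
Unshelve. all: by end_near. Qed.

End mollified_splines.

(** * Weak derivatives tested against splines *)

Section weak_derivatives_and_splines.
Context {R : realType}.
Implicit Types (f g h u : R -> R) (a b x M : R) (c e : int -> R) (n l k N : nat).
Local Notation mu := (@lebesgue_measure R).

Lemma itv_integrableM f h a b : mu.-integrable `[a, b] (EFin \o f) ->
  continuous h -> mu.-integrable `[a, b] (EFin \o (fun x => f x * h x)).
Proof.
move=> fi ch; have mD : measurable (`[a, b]%classic : set (measurableTypeR R)).
  exact: measurable_itv.
have [M [_ HM]] : bounded_set (h @` `[a, b]).
  apply: compact_bounded; apply: continuous_compact; last exact: segment_compact.
  exact: continuous_subspaceT.
apply: (@integrable_mul_bounded _ _ f h (`|M| + 1)) => //.
  by apply: measurable_funTS; apply: continuous_measurable_fun.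
move=> x Dx; apply: HM; last by exists x.
by rewrite (le_lt_trans (ler_norm M)) // ltrDl.
Qed.

Lemma Rintegral_test_cvg f a b M (h_ : nat -> R -> R) h :
  locally_integrable setT f -> (forall m, continuous (h_ m)) ->
  (forall m x, `|h_ m x| <= M) ->
  (forall m x, ~ (a <= x <= b) -> h_ m x = 0) ->
  (forall x, h_ m x @[m --> \oo] --> h x) ->
  \int[mu]_x (f x * h_ m x) @[m --> \oo] --> \int[mu]_x (f x * h x).
Proof.
move=> fl ch hM h0 hh; pose D : set (measurableTypeR R) := `[a, b]%classic.
have mD : measurable D by exact: measurable_itv.
have fi := locally_integrable_itv a b fl.
have E F : (forall x, ~ (a <= x <= b) -> F x = 0) ->
    \int[mu]_x (f x * F x) = \int[mu]_(x in D) (f x * F x).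
  by move=> F0; apply: Rintegral_support => x Dx; rewrite F0 ?mulr0.
have h0' x : ~ (a <= x <= b) -> h x = 0.
  move=> xab; have := hh x; under eq_fun do rewrite h0 //.
  by move/(cvg_unique _ (@cvg_cst _ 0 _ \oo _)) => <-.
rewrite (E h) // (_ : (fun m => _) =
    fun m => \int[mu]_(x in D) (f x * h_ m x)); last first.
  by apply/funext => m; exact/E/h0.
refine (proj2 (@Rintegral_dominated_cvg R D (fun m x => f x * h_ m x)
  (fun x => f x * h x) (fun x => M * `|f x|) mD _ _ _ _)).
- move=> m; apply: measurable_funM.
    by apply/measurable_EFinP; exact: measurable_int fi.
  by apply: measurable_funTS; exact: continuous_measurable_fun.
- by move=> x _; apply: cvgM; [exact: cvg_cst|exact: hh].
- apply: itv_integrableZ; exact: (integrable_norm fi).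
- by move=> m x _; rewrite normrM mulrC ler_wpM2r.
Qed.

Lemma iter_nabla_shift l c (m : int) :
  iter l nabla (fun i => c (i + m)) = (fun i => iter l nabla c (i + m)).
Proof.
elim: l => //= l ->; apply/funext => i; rewrite /nabla.
by rewrite (addrAC i).
Qed.

Lemma csp_delta_shift n l (j : int) x :
  iter l dif (csp n (delta 0)) (x - j%:~R) = csp n (iter l nabla (delta j)) x.
Proof.
rewrite -csp_iter_nabla -mulrNz -csp_shift -iter_nabla_shift.
congr (csp n (iter l nabla _) x); apply/funext => i.
by rewrite /delta subr_eq0.
Qed.

(** The mollified B-splines are test functions for which the defining identity holds exactly, and
    their derivatives are differences with the same structure. Uniform bounds and a common compact
    support allow passing to the limit on both sides. *)
Lemma weak_derivative_delta n l N (j : nat) u g : (0 < N)%N ->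
  weak_derivative setT l u g ->
  \int[mu]_x (u x * (N%:R ^+ l * csp n (iter l nabla (delta j)) (N%:R * x))) =
  (-1) ^+ l * \int[mu]_x (g x * csp (n + l) (delta j) (N%:R * x)).
Proof.
move=> N0 [ul gl H]; have N0' : 0 < N%:R :> R by rewrite ltr0n.
have e0 m : 0 < m.+1%:R^-1 :> R by rewrite invr_gt0.
have e1 m : m.+1%:R^-1 <= 1 :> R by rewrite invf_le1 // ler1n.
pose phi m x : R := mbspline m.+1%:R^-1 (n + l) (N%:R * x + - j%:R).
have Cphi m k : classC k (phi m) by apply: classC_affine; exact: classC_mbspline.
(* The margin 1 on the left accommodates every mollification parameter, all of which are at most
   1. *)
pose a : R := (j%:R - 1) / N%:R; pose b : R := (j%:R + (n + l).+1%:R) / N%:R.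
have sup m y : ~ (a <= y <= b) ->
    N%:R * y + - j%:R < - m.+1%:R^-1 \/ (n + l).+1%:R <= N%:R * y + - j%:R.
  rewrite /a /b ler_pdivrMr // ler_pdivlMr // (mulrC y) => /negP.
  rewrite negb_and -!ltNge => /orP[] yab; [left|right]; last lra.
  by have := e1 m; move: (_^-1) yab => e; lra.
have phi0 m y : ~ (a <= y <= b) -> phi m y = 0.
  move=> /(sup m) [] yab; apply: mbspline_support => //; [left|right] => //.
  exact: ltW.
have D m y : derive1n l (phi m) y =
    N%:R ^+ l * iter l dif (mbspline m.+1%:R^-1 n) (N%:R * y + - j%:R).
  by rewrite /phi (@derive1n_affine _ l l) ?derive1n_mbspline //; exact: classC_mbspline.
have Dc m : continuous (derive1n l (phi m)).
  apply: (@classC_continuous _ 0); apply: classC_derive1n; exact: Cphi.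
have T m : test_function setT (phi m).
  split; first by move=> k; exact: Cphi.
  exists `[a, b]%classic; split => //; first exact: segment_compact.
  by move=> y yab; apply: phi0; move=> ab; apply: yab; rewrite /= in_itv.
have L : \int[mu]_x (u x * derive1n l (phi m) x) @[m --> \oo] -->
    \int[mu]_x (u x * (N%:R ^+ l * csp n (iter l nabla (delta j)) (N%:R * x))).
  apply: (@Rintegral_test_cvg u a b (N%:R ^+ l * (2 ^+ l * 1))) => //.
  - move=> m x; rewrite D normrM ger0_norm ?exprn_ge0 // ler_wpM2l ?exprn_ge0 //.
    by apply: iter_dif_bound => y; exact: mbspline_le1.
  - move=> m x /(sup m) yab; rewrite D.
    rewrite (@iter_dif_support _ l (mbspline m.+1%:R^-1 n) (- m.+1%:R^-1)
      n.+1%:R) ?mulr0 //.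
      move=> y [y1|y1]; apply: mbspline_support => //; [left|right] => //.
      exact: ltW.
    by rewrite -natrD addSn.
  - move=> x; under eq_fun do rewrite D; apply: cvgM; first exact: cvg_cst.
    rewrite -csp_delta_shift; apply: iter_dif_cvg; exact: mbspline_cvg.
have L' : \int[mu]_x (g x * phi m x) @[m --> \oo] -->
    \int[mu]_x (g x * csp (n + l) (delta j) (N%:R * x)).
  apply: (@Rintegral_test_cvg g a b 1) => //.
  - by move=> m; exact: (classC_continuous (Cphi m 0)).
  - by move=> m x; exact: mbspline_le1.
  - move=> x; rewrite -(csp_delta_shift (n + l) 0); exact: mbspline_cvg.
have L2 : \int[mu]_x (u x * derive1n l (phi m) x) @[m --> \oo] -->
    (-1) ^+ l * \int[mu]_x (g x * csp (n + l) (delta j) (N%:R * x)).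
  under eq_fun do rewrite H //.
  by apply: cvgM; [exact: cvg_cst|exact: L'].
exact: cvg_unique L L2.
Qed.

(** * Folding integrals over the line onto one period *)

Lemma Rintegral_fold f h : periodic f 1 -> locally_integrable setT f ->
  continuous h -> (forall x, x < 0 \/ 2 <= x -> h x = 0) ->
  \int[mu]_x (f x * h x) = \int[mu]_(x in `[0, 1]) (f x * (h x + h (x + 1))).
Proof.
move=> f1 fl ch h0; have fi a b := locally_integrable_itv a b fl.
have ch1 : continuous (fun x => h (x + 1)).
  rewrite (_ : (fun x => _) = fun x => h (1 * x + 1)).
    by apply: (@classC_continuous _ 0); apply: classC_affine; apply/classC0.
  by apply/funext => z; rewrite mul1r.
rewrite (@Rintegral_support _ _ `[0, 2]%classic); last first.
  move=> x; rewrite /= in_itv /= => /negP; rewrite negb_and -!ltNge => x02.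
  by rewrite h0 ?mulr0 //; case/orP: x02; [left|right; exact: ltW].
rewrite (@Rintegral_split _ _ 0 1) ?ler01 ?ler1n //; last exact: itv_integrableM.
under [RHS]eq_Rintegral do rewrite mulrDr.
rewrite RintegralD //; [|exact: itv_integrableM..]; congr (_ + _).
have := @Rintegral_translate R (fun x => f x * h x) 0 1 1.
rewrite add0r -[1 + 1]/(2 : R) => <-.
- by apply: eq_Rintegral => x _; rewrite f1.
- case: fl => mf _ _; apply: measurable_funM => //.
  exact: continuous_measurable_fun.
- have -> : (fun x => f (x + 1) * h (x + 1)) = (fun x => f x * h (x + 1)).
    by apply/funext => x; rewrite f1.
  exact: itv_integrableM.
Qed.

Lemma csp_sum n (I : Type) (s : seq I) (k : I -> R) (c : I -> int -> R) x :
  csp n (fun i => \sum_(j <- s) k j * c j i) x = \sum_(j <- s) k j * csp n (c j) x.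
Proof.
elim: s => [|j s IH].
  by rewrite big_nil -[RHS](csp_cst n 0 x); congr csp; apply/funext => i;
    rewrite big_nil.
rewrite big_cons -IH /csp -hornerZ -spieceZ -hornerD -spieceD.
by congr (_.[_]); apply: spiece_ext => i _; rewrite big_cons.
Qed.

Lemma iter_nabla_sum l (I : Type) (s : seq I) (k : I -> R) (c : I -> int -> R) :
  iter l nabla (fun i => \sum_(j <- s) k j * c j i) =
  fun i => \sum_(j <- s) k j * iter l nabla (c j) i.
Proof.
elim: l => //= l ->; apply/funext => i; rewrite /nabla -sumrB.
by apply: eq_bigr => j _; rewrite mulrBr.
Qed.

Lemma iter_nabla_local l c e (i : int) :
  (forall j : int, i - l%:Z <= j <= i -> c j = e j) ->
  iter l nabla c i = iter l nabla e i.
Proof.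
elim: l i => [|l IH] i H; first by apply: H; lia.
by rewrite !iterS /nabla !IH // => j jl; apply: H; lia.
Qed.

Lemma csp_local n c e N x : 0 <= x <= N.+1%:R ->
  (forall i : int, - n.+1%:Z <= i < N.+1%:Z -> c i = e i) ->
  csp n.+1 c x = csp n.+1 e x.
Proof.
move=> /andP[x0 xN] ce.
have [i [i0 iN ix]] : exists i : int,
    [/\ 0 <= i, i < N.+1%:Z & i%:~R <= x <= i%:~R + 1].
  have /andP[fx xf] := floor_itv x.
  have f0 : 0 <= Num.floor x by rewrite floor_ge0.
  have [fN|Nf] := ltP (Num.floor x) N.+1%:Z.
    by exists (Num.floor x); split=> //; rewrite fx ltW // -intrD1.
  (* Only the right end [x = N.+1] is left; it is assigned to the last cell, closed on the right. *)
  exists N%:Z; split=> //; first by rewrite ltz_nat.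
  have : N.+1%:R <= x.
    apply: le_trans fx; rewrite -[N.+1%:R]/(N.+1%:Z%:~R); by rewrite ler_int.
  by rewrite -[N.+1]addn1 natrD; move: xN; rewrite -[N.+1]addn1 natrD;
    rewrite -pmulrn; lra.
rewrite !(csp_cellc _ _ ix); congr (_.[_]); apply: spiece_ext => k kn.
by apply: ce; lia.
Qed.

(** For [i] between [- N] and [N], exactly one index [j] of the period equals [i] or [i + N]. *)
Lemma delta_fold N e (i : int) : periodic e N%:Z -> - N%:Z <= i < N%:Z ->
  \sum_(j < N) e j%:Z * (delta j%:Z i + delta j%:Z (i + N%:Z)) = e i.
Proof.
move=> eN iN.
have [j jE] : exists j : 'I_N, i = j%:Z \/ i + N%:Z = j%:Z.
  have [i0|i0] := leP 0 i.
    have H : (absz i < N)%N by lia.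
    by exists (Ordinal H); left; rewrite /= gez0_abs.
  have H : (absz (i + N%:Z)%R < N)%N by lia.
  by exists (Ordinal H); right; rewrite /= gez0_abs //; lia.
have ej : e j%:Z = e i by case: jE => <-.
rewrite (bigD1 j) //= big1 ?addr0 => [|m mj].
  rewrite ej /delta; have jN := ltn_ord j.
  have -> : (i == j%:Z)%:R + (i + N%:Z == j%:Z)%:R = 1 :> R.
    by case: eqP => E1; case: eqP => E2; rewrite ?addr0 ?add0r //; lia.
  by rewrite mulr1.
have mj' : m <> j :> nat by move=> E; case/eqP: mj; exact: val_inj.
have mN := ltn_ord m; have jN := ltn_ord j.
rewrite /delta; case: eqP => E1; first by lia.
by case: eqP => E2; [lia|rewrite addr0 mulr0].
Qed.

(** On one period the spline and its [l] differences involve coefficients of index at least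
    [- (n + 1 + l)]. The condition on [N] keeps these within one period to the left, where a single
    translate reproduces [e]. *)
Lemma csp_delta_fold n l N e x : (n.+1 + l <= N)%N -> periodic e N%:Z ->
  0 <= x <= N%:R ->
  \sum_(j < N) e j%:Z * (csp n.+1 (iter l nabla (delta j%:Z)) x +
    csp n.+1 (iter l nabla (delta j%:Z)) (x + N%:R)) =
  csp n.+1 (iter l nabla e) x.
Proof.
case: N => [|N] nlN eN xN; first by rewrite ltn0 in nlN.
pose d (j : int) i := delta j i + delta j (i + N.+1%:Z) : R.
have nablaD j : iter l nabla (d j) = fun i => iter l nabla (delta j) i +
    iter l nabla (fun t => delta j (t + N.+1%:Z)) i.
  elim: l {nlN} => //= l ->; apply/funext => i; rewrite /nabla.
  by rewrite opprD addrACA.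
transitivity (\sum_(j < N.+1) e j%:Z * csp n.+1 (iter l nabla (d j%:Z)) x).
  apply: eq_bigr => j _; rewrite nablaD iter_nabla_shift cspD; congr (_ * (_ + _)).
  by rewrite csp_shift.
rewrite -csp_sum -iter_nabla_sum; apply: csp_local xN _ => i iN.
by apply: iter_nabla_local => j jl; apply: delta_fold => //; lia.
Qed.

Lemma csp_delta_support n x : x < 0 \/ n.+1%:R <= x -> csp n (delta 0) x = 0.
Proof.
move=> H; rewrite /csp /spiece big1 ?horner0 // => k _.
have kn := ltn_ord k; have : Num.floor x < 0 \/ n.+1%:Z <= Num.floor x.
  case: H => H; [left|right]; first by rewrite floor_lt0.
  by rewrite floor_ge_int.
by rewrite /delta => fx; case: eqP => [|_]; [lia|rewrite scale0r].
Qed.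

Lemma continuous_csp_scaled n c (a : R) :
  continuous (fun x => csp n.+1 c (a * x)).
Proof.
rewrite (_ : (fun x => _) = fun x => csp n.+1 c (a * x + 0)).
  apply: (@classC_continuous _ 0); apply: classC_affine; apply/classC0.
  exact: continuous_csp.
by apply/funext => z; rewrite addr0.
Qed.

Lemma Rintegral_delta_sum n l N f a e : (n.+2 + l <= N)%N ->
  periodic f 1 -> locally_integrable setT f -> periodic e N%:Z ->
  \sum_(j < N) e j%:Z *
    \int[mu]_x (f x * (a * csp n.+1 (iter l nabla (delta j%:Z)) (N%:R * x))) =
  \int[mu]_(x in `[0, 1]) (f x * (a * csp n.+1 (iter l nabla e) (N%:R * x))).
Proof.
move=> nlN f1 fl eN; pose A (j : 'I_N) : R -> R := csp n.+1 (iter l nabla (delta j%:Z)).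
have cA j : continuous (fun x => a * A j (N%:R * x)).
  apply: (@classC_continuous _ 0); apply: classCZ; apply/classC0.
  exact: continuous_csp_scaled.
have cA1 j : continuous (fun x => a * A j (N%:R * (x + 1))).
  rewrite (_ : (fun x => _) = fun x => a * A j (N%:R * (1 * x + 1))).
    apply: (@classC_continuous _ 0).
    apply: (@classC_affine _ 0 (fun x => a * A j (N%:R * x)) 1 1).
    exact/classC0.
  by apply/funext => z; rewrite mul1r.
transitivity (\sum_(j < N) e j%:Z * \int[mu]_(x in `[0, 1])
    (f x * (a * A j (N%:R * x) + a * A j (N%:R * (x + 1))))).
  apply: eq_bigr => j _; congr (_ * _).
  rewrite (@Rintegral_fold f (fun x => a * A j (N%:R * x))) // => x H.
  (* In units of the mesh, the differenced B-spline of index [j < N] is supported in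
     [[j, j + n + 2 + l]], hence within two periods. *)
  rewrite /A -csp_delta_shift (@iter_dif_support _ l _ 0 n.+2%:R) ?mulr0 //.
    exact: csp_delta_support.
  have jN : (j%:Z%:~R + 1 <= N%:R :> R).
    by rewrite -pmulrn natr1 ler_nat.
  have nlN' : n.+2%:R + l%:R <= N%:R :> R by rewrite -natrD ler_nat.
  have j0 : 0 <= j%:Z%:~R :> R by rewrite ler0z.
  by case: H => H; [left|right]; nra.
have mD : measurable (`[0, 1]%classic : set (measurableTypeR R)).
  exact: measurable_itv.
have Fi (j : 'I_N) : mu.-integrable `[0, 1] (EFin \o (fun x => f x *
    (a * A j (N%:R * x) + a * A j (N%:R * (x + 1))))).
  apply: itv_integrableM; first exact: locally_integrable_itv.
  by move=> x; apply: cvgD; [exact: cA|exact: cA1].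
have [_ <-] := Rintegral_sum (index_enum 'I_N) (fun j => e j%:Z) mD Fi.
apply: eq_Rintegral => x; rewrite inE /= in_itv /= => x01.
rewrite -(@csp_delta_fold n l N) //; last 2 first.
- by rewrite (leq_trans _ nlN) // leq_add2r.
- have NN : 0 <= N%:R :> R by rewrite ler0n.
  by case/andP: x01 => x0 x1; apply/andP; split; nra.
rewrite !mulr_sumr; apply: eq_bigr => j _.
rewrite /A; have -> : N%:R * (x + 1) = N%:R * x + N%:R by rewrite mulrDr mulr1.
by ring.
Qed.

(** Integration by parts over one period against a spline that is not smooth: the identity for
    single B-splines on the line is summed with the weights [e j], and both sides are folded. *)
Lemma weak_derivative_csp n l N u g e : (n.+1 + l < N)%N ->
  periodic u 1 -> periodic g 1 -> periodic e N%:Z ->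
  weak_derivative setT l u g ->
  \int[mu]_(x in `[0, 1])
    (u x * (N%:R ^+ l * csp n.+1 (iter l nabla e) (N%:R * x))) =
  (-1) ^+ l * \int[mu]_(x in `[0, 1]) (g x * csp (n.+1 + l) e (N%:R * x)).
Proof.
move=> nlN u1 g1 eN ug; have [ul gl _] := ug.
have N0 : (0 < N)%N by exact: leq_ltn_trans nlN.
rewrite -(@Rintegral_delta_sum n l N) //.
have := @Rintegral_delta_sum (n + l) 0 N g 1 e; rewrite addn0 /= => H.
under [X in _ * X]eq_Rintegral do rewrite -[csp _ _ _]mul1r.
rewrite -H // mulr_sumr; apply: eq_bigr => j _.
rewrite mulrCA; congr (_ * _).
rewrite (weak_derivative_delta n.+1 _ N0 ug); congr (_ * _).
by apply: eq_Rintegral => x _; rewrite mul1r.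
Qed.

End weak_derivatives_and_splines.

(** * The projection identity *)

Section projection_identity.
Context {R : realType}.
Implicit Types (f g h u v : R -> R) (a b x M : R) (c d e : int -> R) (n l k N : nat).
Local Notation mu := (@lebesgue_measure R).

Lemma Rintegral_cells f N : (0 < N)%N -> mu.-integrable `[0, 1] (EFin \o f) ->
  \int[mu]_(x in `[0, 1]) f x =
  \sum_(i < N) \int[mu]_(x in `[i%:R / N%:R, i.+1%:R / N%:R]) f x.
Proof.
move=> N0 fi; have N0' : 0 < N%:R :> R by rewrite ltr0n.
have H m : (m <= N)%N -> \int[mu]_(x in `[0, m%:R / N%:R]) f x =
    \sum_(i < m) \int[mu]_(x in `[i%:R / N%:R, i.+1%:R / N%:R]) f x.
  elim: m => [|m IH] mN.
    by rewrite mul0r set_itv1 Rintegral_set1 big_ord0.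
  rewrite big_ord_recr /= -IH ?(ltnW mN) //; apply: Rintegral_split.
    by rewrite divr_ge0 //= ler_pM2r ?invr_gt0 // ler_nat.
  apply: integrableS fi => //; apply: subset_itv; rewrite bnd_simp ?lexx //.
  by rewrite ler_pdivrMr // mul1r ler_nat.
by rewrite -H // divff // gt_eqF.
Qed.

(** Links the algebraic [ip] with the Lebesgue integral over a cell of the scaled grid. *)
Lemma Rintegral_cell_poly (p : {poly R}) N (i : nat) : (0 < N)%N ->
  \int[mu]_(x in `[i%:R / N%:R, i.+1%:R / N%:R]) p.[N%:R * x - i%:R] =
  N%:R^-1 * (pint p).[1].
Proof.
move=> N0; have N0' : 0 < N%:R :> R by rewrite ltr0n.
have NN : N%:R != 0 :> R by rewrite gt_eqF.
pose F x : R := N%:R^-1 * (pint p).[N%:R * x + - i%:R].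
have dF x : is_derive x 1 F (p.[N%:R * x - i%:R]).
  have D : is_derive x 1 (fun y => (pint p).[N%:R * y + - i%:R])
      (p.[N%:R * x + - i%:R] * N%:R).
    by apply: is_derive_affine; rewrite -{2}(deriv_pint p); exact: is_derive_poly.
  apply: (is_derive_eq (is_deriveZ (N%:R^-1) D)).
  by rewrite /GRing.scale /= mulrCA mulVf ?mulr1.
have ii : i%:R / N%:R <= i.+1%:R / N%:R :> R.
  by rewrite ler_pM2r ?invr_gt0 // ler_nat.
have cp : continuous (fun x => p.[N%:R * x - i%:R]).
  apply: (@classC_continuous _ 0); apply: classC_affine; apply/classC0.
  exact: continuous_horner.
rewrite (continuous_FTC ii cp dF) /F !(mulrCA N%:R) divff // !mulr1 subrr.
by rewrite horner_pint0 mulr0 subr0 -natr1 addrAC subrr add0r.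
Qed.

(* [N] times the [L^2] inner product on [[0, 1]] of the two splines of degree [n]
   on the grid of mesh [1 / N]. *)
Definition cell_form n N c e : R :=
  \sum_(i < N) ip (spiece n c i%:Z) (spiece n e i%:Z).

Lemma inner01_csp n N c e : (0 < N)%N ->
  inner01 (fun x => csp n.+1 c (N%:R * x)) (fun x => csp n.+1 e (N%:R * x)) =
  N%:R^-1 * cell_form n.+1 N c e.
Proof.
move=> N0; have N0' : 0 < N%:R :> R by rewrite ltr0n.
rewrite /inner01 (@Rintegral_cells _ N) //; last first.
  apply: itv_integrableM; last exact: continuous_csp_scaled.
  by apply: continuous_itv_integrable; exact: continuous_csp_scaled.
rewrite /cell_form mulr_sumr; apply: eq_bigr => i _.
rewrite /ip -(@Rintegral_cell_poly _ N i) //; apply: eq_Rintegral => x.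
rewrite inE /= in_itv /= ler_pdivrMr // ler_pdivlMr // (mulrC x) => /andP[x1 x2].
have ix : i%:Z%:~R <= N%:R * x <= i%:Z%:~R + 1.
  by rewrite -pmulrn x1 natr1.
by rewrite !(csp_cellc _ _ ix) hornerM -pmulrn.
Qed.

(** * Translation invariance of the Gram form and summation by parts *)

Lemma sum_periodic1 (F : int -> R) N : periodic F N%:Z ->
  \sum_(i < N) F (i%:Z - 1) = \sum_(i < N) F i%:Z.
Proof.
case: N => [|N] FN; first by rewrite !big_ord0.
rewrite big_ord_recl big_ord_recr /= addrC; congr (_ + _).
  by rewrite -FN; congr F; lia.
by apply: eq_bigr => i _; congr F; rewrite /bump /=; lia.
Qed.

Lemma sum_periodic (F : int -> R) N (m : int) : periodic F N%:Z ->
  \sum_(i < N) F (i%:Z - m) = \sum_(i < N) F i%:Z.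
Proof.
have H F' (m' : nat) : periodic F' N%:Z ->
    \sum_(i < N) F' (i%:Z - m'%:Z) = \sum_(i < N) F' i%:Z :> R.
  move=> FN; elim: m' => [|m' IH].
    by apply: eq_bigr => i _; rewrite subr0.
  rewrite -IH -(@sum_periodic1 (fun i => F' (i - m'%:Z))).
    by apply: eq_bigr => i _; congr F'; lia.
  by move=> i; rewrite -(FN (i - m'%:Z)); congr F'; lia.
case: m => m FN; first exact: H.
rewrite -(@H (fun i => F (i + m.+1%:Z)) m.+1).
  by apply: eq_bigr => i _; congr F; lia.
by move=> i; rewrite -(FN (i + m.+1%:Z)); congr F; lia.
Qed.

Lemma cell_form_shift n N c e (m : int) : periodic c N%:Z -> periodic e N%:Z ->
  cell_form n N (fun i => c (i - m)) (fun i => e (i - m)) = cell_form n N c e.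
Proof.
move=> cN eN; rewrite /cell_form.
under eq_bigr do rewrite !(spiece_shift n _ (- m)).
apply: (@sum_periodic (fun i => ip (spiece n c i) (spiece n e i)) N m) => i.
by rewrite -!spiece_shift; congr ip; apply: spiece_ext => k _.
Qed.

Lemma periodic_nabla l N c : periodic c N%:Z -> periodic (iter l nabla c) N%:Z.
Proof.
move=> cN; elim: l => //= l IH i; rewrite /nabla IH; congr (_ - _).
by rewrite addrAC IH.
Qed.

Lemma cell_form_nabla1 n N c e : periodic c N%:Z -> periodic e N%:Z ->
  cell_form n N c (nabla e) = - cell_form n N (nabla c) (fun i => e (i - 1)).
Proof.
move=> cN eN.
have Er c' : cell_form n N c' (nabla e) =
    cell_form n N c' e - cell_form n N c' (fun i => e (i - 1)).
  rewrite /cell_form -sumrB; apply: eq_bigr => i _.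
  rewrite [spiece n (nabla e) _]spieceB ipDr; congr (_ + _).
  by rewrite -scaleN1r ipZr mulN1r.
have El e' : cell_form n N (nabla c) e' =
    cell_form n N c e' - cell_form n N (fun i => c (i - 1)) e'.
  rewrite /cell_form -sumrB; apply: eq_bigr => i _.
  rewrite [spiece n (nabla c) _]spieceB ipC ipDr ipC; congr (_ + _).
  by rewrite -scaleN1r ipZr mulN1r ipC.
by rewrite Er El (cell_form_shift n 1 cN eN) opprB.
Qed.

(** The adjoint of the backward difference is minus the forward difference; the discrepancy between
    the two is recorded as the shift of [e] by [l]. *)
Lemma cell_form_nabla n N l c e : periodic c N%:Z -> periodic e N%:Z ->
  cell_form n N c (iter l nabla e) =
  (-1) ^+ l * cell_form n N (iter l nabla c) (fun i => e (i - l%:Z)).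
Proof.
elim: l c e => [|l IH] c e cN eN.
  by rewrite mul1r; congr cell_form; apply/funext => i; rewrite subr0.
rewrite iterS cell_form_nabla1 //; last exact: periodic_nabla.
rewrite -(iter_nabla_shift l e (-1)) IH; last 2 first.
- exact: (@periodic_nabla 1).
- by move=> i; rewrite addrAC eN.
rewrite exprS mulN1r mulNr; congr (- (_ * cell_form _ _ _ _)).
  by rewrite -iterSr.
by apply/funext => i; congr e; lia.
Qed.

Lemma cell_formZl n N a c e :
  cell_form n N (fun i => a * c i) e = a * cell_form n N c e.
Proof.
rewrite /cell_form mulr_sumr; apply: eq_bigr => i _.
by rewrite spieceZ ipC ipZr ipC.
Qed.

(** The projection is tested with the spline whose coefficients are an [l]-th difference. Summation
    by parts moves the differences onto [c], integration by parts turns them into the weak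
    derivative of [u], and the two signs cancel. *)
Lemma projection_weak_derivative n l N u g c e : (n.+1 + l < N)%N ->
  periodic u 1 -> periodic g 1 -> periodic c N%:Z -> periodic e N%:Z ->
  weak_derivative setT l u g ->
  L2_projection n.+2 N u (fun x => csp n.+1 c (N%:R * x)) ->
  N%:R^-1 * cell_form n.+1 N (fun i => N%:R ^+ l * iter l nabla c i) e =
  \int[mu]_(x in `[0, 1])
    (g x * csp (n.+1 + l) (fun i => e (i + l%:Z)) (N%:R * x)).
Proof.
move=> nlN u1 g1 cN eN ug [_ P]; have [ul gl _] := ug.
have N0 : (0 < N)%N by exact: leq_ltn_trans nlN.
(* Advancing by [l] compensates the shift produced by summation by parts. *)
pose e' i := e (i + l%:Z).
have e'N : periodic e' N%:Z by move=> i; rewrite /e' addrAC eN.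
have := P _ (spline_csp n N0 (periodic_nabla l e'N)).
rewrite inner01_csp // cell_form_nabla //.
have -> : (fun i => e' (i - l%:Z)) = e.
  by apply/funext => i; rewrite /e' subrK.
move=> H.
have := weak_derivative_csp nlN u1 g1 e'N ug.
have -> : \int[mu]_(x in `[0, 1])
    (u x * (N%:R ^+ l * csp n.+1 (iter l nabla e') (N%:R * x))) =
    N%:R ^+ l * inner01 u (fun x => csp n.+1 (iter l nabla e') (N%:R * x)).
  rewrite /inner01 -RintegralZl //.
    by apply: eq_Rintegral => x _; rewrite mulrCA.
  apply: itv_integrableM; first exact: locally_integrable_itv.
  exact: continuous_csp_scaled.
have s0 : (-1) ^+ l != 0 :> R by rewrite signr_eq0.
by move=> E; apply: (mulfI s0); rewrite -E -H cell_formZl; ring.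
Qed.

End projection_identity.

(** * Stability of B-spline coefficients *)

Section stability.
Context {R : realType}.
Implicit Types (p : {poly R}) (c d e w : int -> R) (n k N : nat) (i m : int).

Lemma spiece_bound n : exists2 C : R, 0 <= C & forall e i t, 0 <= t <= 1 ->
  `|(spiece n e i).[t]| <= C * \sum_(k < n.+1) `|e (i - k%:Z)|.
Proof.
pose pnorm p := \sum_(j < size p) `|p`_j|.
have p0 p : 0 <= pnorm p by exact: sumr_ge0.
have pn p t : 0 <= t <= 1 -> `|p.[t]| <= pnorm p.
  move=> /andP[t0 t1]; rewrite horner_coef (le_trans (ler_norm_sum _ _ _)) //.
  apply: ler_sum => j _; rewrite normrM -[leRHS]mulr1 ler_wpM2l //.
  by rewrite ger0_norm ?exprn_ge0 // exprn_ile1.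
exists (\sum_(k < n.+1) pnorm (bpiece n k)); first exact: sumr_ge0.
move=> e i t t01; rewrite /spiece horner_sum (le_trans (ler_norm_sum _ _ _)) //.
rewrite mulr_sumr; apply: ler_sum => k _; rewrite hornerZ normrM mulrC.
rewrite ler_wpM2r // (le_trans (pn _ _ t01)) // (bigD1 k) //= lerDl.
exact: sumr_ge0.
Qed.

Lemma spiece_l2 n : exists2 K : R, 0 < K & forall d i,
  d i ^+ 2 <= K * ip (spiece n d i) (spiece n d i).
Proof.
have [K K0 HK] := @bpiece_stable R n; exists K => // d i.
by have := HK (fun k => d (i - k%:Z)) 0%N (leq0n n); rewrite subr0.
Qed.

(** A commutator estimate: the spline with coefficients [w d] is [w i] times [s] plus terms carrying
    [w (i - k) - w i]. Local stability bounds each inner product in those terms by a multiple of the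
    energy of the same cell. *)
Lemma weighted_stable n : exists2 D : R, 1 <= D & forall w d i eps, 0 <= w i ->
  (forall k, (k <= n)%N -> `|w (i - k%:Z) - w i| <= eps * w i) ->
  w i * ip (spiece n d i) (spiece n d i) * (1 - eps * D) <=
  ip (spiece n d i) (spiece n (fun j => w j * d j) i).
Proof.
have [K K0 HK] := @bpiece_stable R n.
(* The natural bound is the square root of [y = K * ip (bpiece n k) (bpiece n k)]; [1 + y] dominates
   it. *)
pose B k : R := 1 + K * ip (bpiece n k) (bpiece n k).
have B1 k : 1 <= B k by rewrite lerDl mulr_ge0 ?ip_ge0 // ltW.
exists (\sum_(k < n.+1) B k).
  rewrite big_ord_recl (le_trans (B1 0%N)) // lerDl sumr_ge0 // => k _.
  exact: le_trans ler01 (B1 _).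
move=> w d i eps w0 Hw; set s := spiece n d i; set A := ip s s.
have A0 : 0 <= A by exact: ip_ge0.
have -> : ip s (spiece n (fun j => w j * d j) i) = w i * A +
    \sum_(k < n.+1) (w (i - k%:Z) - w i) * (d (i - k%:Z) * ip s (bpiece n k)).
  rewrite /A [in X in _ * X]/s /spiece !ip_sumr mulr_sumr -big_split.
  by apply: eq_bigr => k _ /=; ring.
have dk k : (k <= n)%N -> `|d (i - k%:Z) * ip s (bpiece n k)| <= A * B k.
  move=> kn; have H1 := HK (fun k => d (i - k%:Z)) k kn.
  rewrite -/(spiece n d i) -/s -/A in H1.
  have H2 := ip_CauchySchwarz s (bpiece n k); rewrite -/A in H2.
  have AB : 0 <= A * B k by rewrite mulr_ge0 // (le_trans ler01).
  rewrite -(ger0_norm AB) -ler_sqr ?nnegrE // !real_normK ?num_real // exprMn.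
  apply: (@le_trans _ _ ((K * A) * (A * ip (bpiece n k) (bpiece n k)))).
    by apply: ler_pM => //; rewrite sqr_ge0.
  have := @ip_ge0 R (bpiece n k); rewrite /B; set b := ip _ _ => b0.
  have Kb0 : 0 <= K * b by rewrite mulr_ge0 // ltW.
  have -> : K * A * (A * b) = A ^+ 2 * (K * b) by ring.
  rewrite exprMn ler_wpM2l ?sqr_ge0 //; move: (K * b) Kb0 => y y0.
  by rewrite expr2; nra.
have : `|\sum_(k < n.+1) (w (i - k%:Z) - w i) * (d (i - k%:Z) * ip s (bpiece n k))|
    <= w i * A * (eps * \sum_(k < n.+1) B k).
  rewrite (le_trans (ler_norm_sum _ _ _)) // !mulr_sumr; apply: ler_sum => k _.
  have kn : (k <= n)%N by rewrite -ltnS.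
  rewrite normrM (_ : w i * A * (eps * B k) = (eps * w i) * (A * B k)); last by ring.
  by apply: ler_pM => //; [exact: Hw|exact: dk].
by move=> /ler_normlP[]; lra.
Qed.

(** Convexity: the right side is the chord of the power between 0 and 1. *)
Lemma exprD1_le n (t : R) : 0 <= t <= 1 -> (1 + t) ^+ n <= 1 + (2 ^+ n - 1) * t.
Proof.
move=> /andP[t0 t1]; elim: n => [|n IH]; first by rewrite !expr0; lra.
rewrite !exprS; have P : 1 <= 2 ^+ n :> R by rewrite exprn_ege1 // ler1n.
apply: (@le_trans _ _ ((1 + t) * (1 + (2 ^+ n - 1) * t))).
  by rewrite ler_wpM2l // addr_ge0.
have : 0 <= (2 ^+ n - 1) * (t * (1 - t)) by rewrite !mulr_ge0 ?subr_ge0.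
by move: (2 ^+ n) P => P P1 H; lra.
Qed.

(* A positive [N]-periodic weight peaked at [m], slowly varying and with total
   mass bounded independently of [N]. *)
Lemma weight_ex (t : R) N m : 0 < t -> (0 < N)%N -> exists w, [/\
  periodic w N%:Z, forall i, 0 <= w i, 1 <= w m,
  forall i, w (i - 1) <= (1 + t) * w i /\ w i <= (1 + t) * w (i - 1) &
  \sum_(i < N) w i%:Z <= 2 * (1 + t) / t].
Proof.
move=> t0 N0; pose q : R := (1 + t)^-1; have t1 : 0 < 1 + t by rewrite addr_gt0.
have q0 : 0 < q by rewrite invr_gt0.
have q1 : q < 1 by rewrite invf_lt1 // ltrDl.
have qt : q * (1 + t) = 1 by rewrite mulVf // gt_eqF.
(* Decay from both ends of the period makes [v N = v 0]; the one-sided [q ^+ j] would jump where the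
   period closes. *)
pose v (j : nat) : R := q ^+ j + q ^+ (N - j).
pose w i : R := v (absz ((i - m) %% N%:Z)%Z).
have NZ : N%:Z != 0 by rewrite eqz_nat -lt0n.
have v0 j : 0 < v j by rewrite addr_gt0 ?exprn_gt0.
have vS j : (j < N)%N -> v j <= (1 + t) * v j.+1 /\ v j.+1 <= (1 + t) * v j.
  move=> jN; have E1 : q ^+ j = (1 + t) * q ^+ j.+1.
    by rewrite exprS mulrA (mulrC (1 + t)) qt mul1r.
  have E2 : q ^+ (N - j.+1) = (1 + t) * q ^+ (N - j).
    by rewrite -(subnSK jN) exprS mulrA (mulrC (1 + t)) qt mul1r.
  have P1 : 0 < q ^+ j.+1 by rewrite exprn_gt0.
  have P2 : 0 < q ^+ (N - j) by rewrite exprn_gt0.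
  rewrite /v E1 E2; split; nra.
have vN : v N = v 0%N by rewrite /v subnn subn0 addrC.
exists w; split.
- by move=> i; rewrite /w addrAC modzDr.
- by move=> i; exact/ltW/v0.
- by rewrite /w subrr mod0z /v expr0 lerDl exprn_ge0 // ltW.
- move=> i; rewrite /w.
  have jN : ((i - m) %% N%:Z)%Z < N%:Z by rewrite ltz_pmod // ltz_nat.
  have j0 : 0 <= ((i - m) %% N%:Z)%Z by rewrite modz_ge0.
  have : modz (i - 1 - m) N%:Z = modz (modz (i - m) N%:Z - 1) N%:Z.
    by rewrite modzDml; congr (_ %% _)%Z; lia.
  move=> ->; set j := ((i - m) %% N%:Z)%Z in j0 jN *.
  case: j j0 jN => [[|j]|] // _ jN.
    (* At the peak the predecessor of residue 0 is [N - 1], and [vN] closes the period. *)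
    rewrite /= (_ : ((0 - 1) %% N%:Z)%Z = N.-1%:Z); last first.
      rewrite -modzDr modz_small; lia.
    have := vS N.-1; rewrite prednK // => /(_ (leqnn _)).
    by rewrite vN /= => -[].
  rewrite (_ : ((j.+1%:Z - 1) %% N%:Z)%Z = j%:Z) /=; last first.
    by rewrite modz_small; lia.
  by apply: vS; lia.
pose F (i : int) := v (absz (i %% N%:Z)%Z).
rewrite (@sum_periodic _ F N m) => [|i]; last first.
  by rewrite /F modzDr.
have -> : \sum_(i < N) F i%:Z = \sum_(i < N) v i.
  by apply: eq_bigr => i _; rewrite /F modz_small //; have := ltn_ord i; lia.
rewrite big_split /= [X in _ + X](reindex_inj rev_ord_inj) /=.
(* Since [1 - q = q t], the series is at most [1 / (q t) = (1 + t) / t]; each half of [v]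
   contributes one such sum. *)
have geo n : \sum_(i < n) q ^+ i <= (1 + t) / t.
  have := subrX1 q n; rewrite -opprB -[in RHS]opprB mulNr => /oppr_inj H.
  have E : 1 - q = q * t by rewrite -qt; ring.
  have : q * t * \sum_(i < n) q ^+ i <= 1.
    by rewrite -E -H gerBl exprn_ge0 // ltW.
  rewrite -ler_pdivlMl ?mulr_gt0 // => /le_trans; apply.
  by rewrite mulr1 /q invfM invrK.
have geo' : \sum_(i < N) q ^+ (N - (N - i.+1)) <= (1 + t) / t.
  have H : \sum_(i < N) q ^+ (N - (N - i.+1)) <= \sum_(i < N) q ^+ i.
    apply: ler_sum => i _; rewrite subKn; last exact: ltn_ord.
    by rewrite exprS ger_pMl ?exprn_gt0 // ltW.
  exact: le_trans H (geo N).
by have := geo N; rewrite -mulrA; lra.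
Qed.

(* Test with [w d], where [w] peaks at the index under consideration. *)
Lemma cell_form_sup n : exists2 K : R, 0 <= K & forall N d B, (0 < N)%N ->
  0 <= B -> periodic d N%:Z ->
  (forall e, periodic e N%:Z -> cell_form n N d e <= B * \sum_(i < N) `|e i%:Z|) ->
  forall m, `|d m| <= K * B.
Proof.
have [K K0 HK] := spiece_l2 n; have [D D1 HD] := weighted_stable n.
have D0 : 0 < D by rewrite (lt_le_trans ltr01).
(* [eps] makes the factor [1 - eps * D] equal to 1/2; by the chord bound, [t] keeps the relative
   variation of the weight over [n] steps below [eps]. *)
pose eps : R := (2 * D)^-1; pose t := eps / 2 ^+ n.
have eps0 : 0 < eps by rewrite invr_gt0 mulr_gt0.
have P2 : 1 <= 2 ^+ n :> R by rewrite exprn_ege1 // ler1n.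
have t0 : 0 < t by rewrite divr_gt0 // (lt_le_trans ltr01).
have eps1 : eps <= 1 by rewrite invf_le1 ?mulr_gt0 //; lra.
have t1 : t <= 1.
  by rewrite ler_pdivrMr ?mul1r ?(le_trans eps1) // (lt_le_trans ltr01).
have tn k : (k <= n)%N -> (1 + t) ^+ k - 1 <= eps.
  move=> kn; have t01 : 0 <= t <= 1 by rewrite ltW.
  have := exprD1_le n t01; have : (1 + t) ^+ k <= (1 + t) ^+ n.
    by rewrite ler_weXn2l // lerDl ltW.
  have -> : eps = 2 ^+ n * t.
    by rewrite /t mulrCA mulfV ?mulr1 // gt_eqF // (lt_le_trans ltr01).
  by have := ltW t0; lra.
pose W : R := 2 * (1 + t) / t.
have W0 : 0 <= W by rewrite divr_ge0 ?mulr_ge0 ?addr_ge0 // ltW.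
(* The argument gives the square bound [4 (K B)^2 W]; using [W <= (1 + W)^2] avoids a square
   root. *)
exists (2 * K * (1 + W)).
  by rewrite mulr_ge0 ?addr_ge0 // mulr_ge0 // ltW.
move=> N d B N0 B0 dN HB m.
have [w [wN w0 wm wS Ws]] := weight_ex m t0 N0; rewrite -/W in Ws.
have wk i k : w (i - k%:Z) <= (1 + t) ^+ k * w i /\ w i <= (1 + t) ^+ k * w (i - k%:Z).
  have tt : 0 <= 1 + t by rewrite addr_ge0 // ltW.
  elim: k => [|k [IH1 IH2]]; first by rewrite subr0 mul1r.
  have -> : i - k.+1%:Z = i - k%:Z - 1 by rewrite -addn1 PoszD opprD addrA.
  have [S1 S2] := wS (i - k%:Z); rewrite exprS; split.
    by rewrite (le_trans S1) // -mulrA ler_wpM2l.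
  by rewrite (le_trans IH2) // (mulrC (1 + t)) -mulrA ler_wpM2l ?exprn_ge0.
have wdiff i k : (k <= n)%N -> `|w (i - k%:Z) - w i| <= eps * w i.
  move=> kn; have [H1 H2] := wk i k; have H3 := tn _ kn; have H4 := w0 i.
  have H5 := w0 (i - k%:Z).
  have H6 : 1 <= (1 + t) ^+ k by rewrite exprn_ege1 // lerDl ltW.
  apply/ler_normlP.
  move: ((1 + t) ^+ k) (w i) (w (i - k%:Z)) H1 H2 H3 H4 H5 H6.
  move=> P Y X H1 H2 H3 H4 H5 H6.
  have PY : (P - 1) * Y <= eps * Y by rewrite ler_wpM2r.
  split; last by lra.
  (* The claim reduces to [(2 - P) Y <= X]. It is clear for [P >= 2]; otherwise it follows from
     [Y <= P X] and [P (2 - P) = 1 - (P - 1)^2 <= 1]. *)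
  have [P2'|P2'] := leP 2 P.
    have : 0 <= (P - 2) * Y by rewrite mulr_ge0 ?subr_ge0.
    lra.
  have : 0 <= (2 - P) * (P * X - Y) by rewrite mulr_ge0 ?subr_ge0 // ltW.
  have : 0 <= (P - 1) ^+ 2 * X by rewrite mulr_ge0 ?sqr_ge0.
  nra.
pose e i := w i * d i.
have eN : periodic e N%:Z by move=> i; rewrite /e wN dN.
pose F i := w i * d i ^+ 2.
have H1 : \sum_(i < N) F i%:Z <= 2 * K * cell_form n N d e.
  rewrite /cell_form mulr_sumr; apply: ler_sum => i _; rewrite /F.
  have := HD w d i%:Z eps (w0 _) (wdiff _); rewrite -/e.
  have -> : 1 - eps * D = 2^-1.
    by rewrite /eps; field; rewrite gt_eqF.
  have := ler_wpM2l (w0 i%:Z) (HK d i%:Z).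
  move: (ip _ _) (ip _ _) => E A; rewrite -mulrA => Hd HE.
  have : 0 <= K * (E - w i%:Z * (A / 2)).
    by apply: mulr_ge0; [exact: ltW|rewrite subr_ge0].
  lra.
have H2 := HB e eN.
(* Young's inequality, with constants chosen so that half of the weighted square sum is absorbed on
   the left and the rest involves only the mass of [w]. *)
have H3 : \sum_(i < N) `|e i%:Z| * (2 * K * B) <=
    \sum_(i < N) (F i%:Z / 2 + 2 * (K * B) ^+ 2 * w i%:Z).
  apply: ler_sum => i _; rewrite /F /e normrM ger0_norm //.
  rewrite -[d i%:Z ^+ 2]real_normK ?num_real //.
  have : 0 <= w i%:Z * (`|d i%:Z| - 2 * (K * B)) ^+ 2.
    by rewrite mulr_ge0 ?sqr_ge0.
  by rewrite sqrrB; lra.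
rewrite big_split /= -mulr_suml -mulr_suml -mulr_sumr in H3.
have F0 i : 0 <= F i by rewrite mulr_ge0 ?sqr_ge0.
have H4 : F m <= \sum_(i < N) F i%:Z.
  have FN : periodic F N%:Z by move=> i; rewrite /F wN dN.
  rewrite -(@sum_periodic _ F N (- m)) // (bigD1 (Ordinal N0)) //= opprK add0r.
  by rewrite lerDl sumr_ge0.
have H5 : F m <= 4 * (K * B) ^+ 2 * W.
  have : 2 * K * cell_form n N d e <= 2 * K * (B * \sum_(i < N) `|e i%:Z|).
    by rewrite ler_wpM2l // mulr_ge0 // ltW.
  have : 2 * (K * B) ^+ 2 * \sum_(i < N) w i%:Z <= 2 * (K * B) ^+ 2 * W.
    by rewrite ler_wpM2l // mulr_ge0 ?sqr_ge0.
  lra.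
have KB : 0 <= 2 * K * (1 + W) * B.
  by rewrite !mulr_ge0 ?addr_ge0 // ltW.
rewrite -ler_sqr ?nnegrE // real_normK ?num_real //.
have : d m ^+ 2 <= F m by rewrite /F ler_peMl ?sqr_ge0.
move=> /le_trans; apply; rewrite (le_trans H5) //.
have -> : (2 * K * (1 + W) * B) ^+ 2 = 4 * (K * B) ^+ 2 * (1 + W) ^+ 2 by ring.
rewrite ler_wpM2l ?mulr_ge0 ?sqr_ge0 //; nra.
Qed.

End stability.

(** * Uniqueness of weak derivatives *)

Section weak_derivative_uniqueness.
Context {R : realType}.
Implicit Types (f g h u v w phi : R -> R) (a b x M : R) (n l k N : nat).
Local Notation mu := (@lebesgue_measure R).

Lemma test_function_support a b phi x : test_function `]a, b[ phi ->
  ~ (a <= x <= b) -> phi x = 0.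
Proof.
move=> [_ [K [_ KO K0]]] xab; apply: K0 => /KO; rewrite /= in_itv /= => /andP[ax xb].
by apply: xab; rewrite !ltW.
Qed.

Lemma test_functionT (Om : set R) phi : test_function Om phi -> test_function setT phi.
Proof. by move=> [? [K [? _ ?]]]; split => //; exists K; split. Qed.

(** The indicator of [[c, d[] is the bounded pointwise limit of differences of two smooth steps. The
    cap [(c - a) / 2] on the parameter keeps their supports inside the open interval. *)
Lemma Rintegral_eq0_of_test f a b c d : locally_integrable setT f ->
  (forall phi, test_function `]a, b[ phi -> \int[mu]_x (f x * phi x) = 0) ->
  a < c -> c <= d -> d < b -> \int[mu]_(x in `[c, d]) f x = 0.
Proof.
move=> fl f0 ac cd db.
pose e m : R := Num.min ((c - a) / 2) m.+1%:R^-1.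
have e0 m : 0 < e m by rewrite lt_min invr_gt0 ltr0Sn andbT divr_gt0 ?subr_gt0.
have ea m : a < c - e m.
  have : e m <= (c - a) / 2 by rewrite ge_min lexx.
  lra.
pose phi m x := smooth_step (e m) (1 * x + - c) - smooth_step (e m) (1 * x + - d).
have Cphi m k : classC k (phi m).
  by apply: classCB; apply: classC_affine; exact: classC_smooth_step.
have phi0 m x : ~ (c - e m <= x <= d) -> phi m x = 0.
  move=> /negP; rewrite negb_and -!ltNge => /orP[H|H]; rewrite /phi !mul1r.
    by rewrite !smooth_step0 ?subrr //; move: (e0 m); lra.
  by rewrite !smooth_step1 ?subrr //; lra.
have T m : test_function `]a, b[ (phi m).
  split; first by move=> k.
  exists `[c - e m, d]%classic; split; first exact: segment_compact.
    move=> x; rewrite /= !in_itv /= => /andP[x1 x2].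
    by rewrite (lt_le_trans (ea m) x1) (le_lt_trans x2 db).
  by move=> x xK; apply: phi0 => H; apply: xK; rewrite /= in_itv.
pose h x : R := (0 <= x - c)%R%:R - (0 <= x - d)%R%:R.
have step_cvg (y : R) : smooth_step (e m) y @[m --> \oo] --> ((0 <= y)%R%:R : R).
  case: leP => y0.
    by under eq_fun do rewrite smooth_step1 //; exact: cvg_cst.
  have Ny : 0 < - y by rewrite oppr_gt0.
  apply: cvg_near_cst; near=> m; apply: smooth_step0.
  rewrite lerNr (@le_trans _ _ m.+1%:R^-1) ?ge_min ?lexx ?orbT // ltW //.
  by near: m; exact: (near_infty_natSinv_lt (PosNum Ny)).
have L : \int[mu]_x (f x * phi m x) @[m --> \oo] --> \int[mu]_x (f x * h x).
  apply: (@Rintegral_test_cvg _ f a b 1) => //.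
  - by move=> m; exact: (classC_continuous (Cphi m 0)).
  - move=> m x; rewrite /phi ler_norml.
    have := smooth_step_ge0 (1 * x + - c) (e0 m).
    have := smooth_step_le1 (1 * x + - c) (e0 m).
    have := smooth_step_ge0 (1 * x + - d) (e0 m).
    have := smooth_step_le1 (1 * x + - d) (e0 m).
    lra.
  - by move=> m x; exact: test_function_support (T m).
  - by move=> x; rewrite /phi /h mul1r; apply: cvgB; exact: step_cvg.
have L0 : \int[mu]_x (f x * h x) = 0.
  move: L; under eq_fun do rewrite f0 //.
  by move/(cvg_unique _ (@cvg_cst _ 0 _ \oo _)) => <-.
rewrite -Rintegral_itv_bndo_bndc; last first.
  apply: (integrableS _ _ _ (locally_integrable_itv c d fl)) => //.
  by apply: subset_itv; rewrite ?bnd_simp.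
rewrite -L0 (@Rintegral_support _ _ `[c, d[%classic).
  apply: eq_Rintegral => x; rewrite inE /= in_itv /= => /andP[x1 x2].
  by rewrite /h !subr_ge0 x1 leNgt x2 subr0 mulr1.
move=> x; rewrite /= in_itv /= /h !subr_ge0 => /negP; rewrite negb_and -ltNge -leNgt.
case/orP => H; last by rewrite (le_trans cd H) H subrr mulr0.
by rewrite !leNgt H (lt_le_trans H cd) subrr mulr0.
Unshelve. all: by end_near. Qed.

(** A primitive of [f] is constant on the interval, and by Lebesgue differentiation its derivative
    is [f] almost everywhere. *)
Lemma du_bois_reymond f a b : locally_integrable setT f ->
  (forall phi, test_function `]a, b[ phi -> \int[mu]_x (f x * phi x) = 0) ->
  {ae mu, forall x, a < x < b -> f x = 0}.
Proof.
move=> fl f0; have fi y := locally_integrable_itv a y fl.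
have := @FTC1 R f (BLeft a) fi fl; apply: filterS.
  exact: (ae_filter_ringOfSetsType mu).
move=> x H /andP[ax xb].
case: H => [|_ <-]; first by rewrite /= lte_fin.
set F := fun y => _.
suff : is_derive x 1 F 0 by case=> _; rewrite derive1E.
apply: (@is_derive_eq_itv _ _ (fun=> F x) a b); rewrite ?ax //.
have Fle y z : a < y -> y <= z -> z < b -> F z = F y.
    move=> ay yz zb; rewrite /F (@Rintegral_split _ f a y z) ?(ltW ay) //.
    by rewrite (Rintegral_eq0_of_test fl f0 ay yz zb) addr0.
  move=> y /andP[ay yb]; have [yx|xy] := leP y x.
    exact/esym/Fle.
  exact/Fle/yb/ltW.
Qed.


Lemma derive1_support f a b x : (forall y, ~ (a <= y <= b) -> f y = 0) ->
  ~ (a <= x <= b) -> derive1 f x = 0.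
Proof.
move=> f0 /negP; rewrite negb_and -!ltNge => xab.
suff : is_derive x 1 f 0 by case=> _; rewrite derive1E.
have D0 : is_derive x 1 (fun=> 0 : R) (0 : R) by exact: is_derive_cst.
case/orP: xab => H.
  apply: (@is_derive_eq_itv _ _ _ (x - 1) a _ _ _ _ D0); first lra.
  by move=> y /andP[_ ya]; apply: f0; rewrite leNgt ya.
apply: (@is_derive_eq_itv _ _ _ b (x + 1) _ _ _ _ D0); first lra.
by move=> y /andP[yb _]; apply: f0; rewrite (leNgt y) yb andbF.
Qed.

Lemma derive1n_support l f a b x : (forall y, ~ (a <= y <= b) -> f y = 0) ->
  ~ (a <= x <= b) -> derive1n l f x = 0.
Proof.
move=> f0; elim: l x => [|l IH] x; first exact: f0.
exact: derive1_support.
Qed.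

Lemma Rintegral_parts (P : nat -> R -> R) l a b phi : a <= b ->
  (forall j x, is_derive x 1 (P j) (P j.+1 x)) ->
  (forall k, classC k phi) -> (forall x, ~ (a <= x <= b) -> phi x = 0) ->
  \int[mu]_x (P 0%N x * derive1n l phi x) =
  (-1) ^+ l * \int[mu]_x (P l x * phi x).
Proof.
move=> ab dP Cphi phi0.
have cP j : continuous (P j).
  move=> x; apply: differentiable_continuous; apply/derivable1_diffP.
  by case: (dP j x).
have one (Q dQ psi : R -> R) : continuous Q -> continuous dQ ->
    (forall x : R, is_derive x 1 Q (dQ x)) -> classC 1 psi ->
    (forall x, ~ (a <= x <= b) -> psi x = 0) ->
    \int[mu]_x (Q x * derive1 psi x) = - \int[mu]_x (dQ x * psi x).
  move=> cQ cdQ DQ Cpsi psi0; have cpsi := classC_continuous Cpsi.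
  have cdpsi := classC_continuous (classCS_derive1 Cpsi).
  have supp (h h' : R -> R) : (forall x, ~ (a <= x <= b) -> h' x = 0) ->
      \int[mu]_x (h x * h' x) = \int[mu]_(x in `[a - 1, b + 1]) (h x * h' x).
    move=> h0; apply: Rintegral_support => x; rewrite /= in_itv /= => xab.
    by rewrite h0 ?mulr0 // => H; apply: xab; lra.
  rewrite !supp //; last by move=> x; exact: derive1_support.
  have ab' : a - 1 <= b + 1 by lra.
  have cg : continuous (fun x => dQ x * psi x + Q x * derive1 psi x).
    move=> x; apply: cvgD; apply: cvgM; [exact: cdQ|exact: cpsi|exact: cQ|].
    exact: cdpsi.
  have DF x : is_derive x 1 (fun x => Q x * psi x)
      (dQ x * psi x + Q x * derive1 psi x).
    apply: (is_derive_eq (is_deriveM (DQ x) (classCS_is_derive x Cpsi))).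
    by rewrite /GRing.scale /= addrC (mulrC (psi x)).
  have := continuous_FTC ab' cg DF; rewrite RintegralD //; last 2 first.
  - by apply: itv_integrableM => //; exact: continuous_itv_integrable.
  - by apply: itv_integrableM => //; exact: continuous_itv_integrable.
  rewrite !psi0 ?mulr0 ?subrr; [|lra|lra].
  by move=> /eqP; rewrite addrC addr_eq0 => /eqP.
elim: l P dP cP => [|l IH] P dP cP; first by rewrite mul1r.
rewrite (one _ (P 1%N)) //; last 2 first.
- by apply: classC_derive1n; exact: Cphi.
- by move=> x; exact: derive1n_support.
by rewrite (IH (fun j => P j.+1)) // exprS mulN1r mulNr.
Qed.

Lemma weak_derivative_unique l u g h a b :
  weak_derivative setT l u g -> weak_derivative setT l u h ->
  {ae mu, forall x, a < x < b -> g x = h x}.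
Proof.
move=> [_ gl Hg] [_ hl Hh].
have ghl : locally_integrable setT (fun x => g x - h x).
  exact: (locally_integrableB gl hl).
have := @du_bois_reymond _ a b ghl; move=> H.
have {}H : {ae mu, forall x, a < x < b -> g x - h x = 0}.
  apply: H => phi Tphi; have Tphi' := test_functionT Tphi.
  have cphi := classC_continuous (Tphi'.1 0%N).
  have supp (f : R -> R) :
      \int[mu]_x (f x * phi x) = \int[mu]_(x in `[a, b]) (f x * phi x).
    apply: Rintegral_support => x; rewrite /= in_itv /= => xab.
    by rewrite (test_function_support Tphi) ?mulr0.
  rewrite supp; under eq_Rintegral do rewrite mulrBl.
  rewrite RintegralB //; last 2 first.
  - by apply: itv_integrableM => //; exact: locally_integrable_itv.
  - by apply: itv_integrableM => //; exact: locally_integrable_itv.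
  rewrite -!supp; have s0 : (-1) ^+ l != 0 :> R by rewrite signr_eq0.
  apply/eqP; rewrite subr_eq0; apply/eqP; apply: (mulfI s0).
  by rewrite -Hg // -Hh.
apply: filterS H; first exact: (ae_filter_ringOfSetsType mu).
by move=> x H xab; apply/eqP; rewrite -subr_eq0 H.
Qed.

(** Working inside one open cell covers [l = n.+1], where the derivative is piecewise constant and
    may jump at the nodes: test functions supported in the cell see only one polynomial, which is
    integrated by parts classically. *)
Lemma weak_derivative_csp_cell n l N c v w (i : nat) : (0 < N)%N ->
  (l <= n.+1)%N -> v = (fun x => csp n.+1 c (N%:R * x)) ->
  weak_derivative setT l v w ->
  {ae mu, forall x, node N i < x < node N i.+1 -> w x =
    (spiece (n.+1 - l) (fun j => N%:R ^+ l * iter l nabla c j) i%:Z).[N%:R * x - i%:R]}.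
Proof.
move=> N0 ln vE [_ wl Hw]; have N0' : 0 < N%:R :> R by rewrite ltr0n.
pose P j x : R := N%:R ^+ j * ((spiece n.+1 c i%:Z)^`(j)).[N%:R * x - i%:R].
have dP j x : is_derive x 1 (P j) (P j.+1 x).
  have D : is_derive x 1 (fun y => ((spiece n.+1 c i%:Z)^`(j)).[N%:R * y + - i%:R])
      (((spiece n.+1 c i%:Z)^`(j.+1)).[N%:R * x + - i%:R] * N%:R).
    by apply: is_derive_affine; rewrite derivnS; exact: is_derive_poly.
  apply: (is_derive_eq (is_deriveZ (N%:R ^+ j) D)).
  by rewrite /P /GRing.scale /= exprSr; ring.
have Pl x : P l x =
    (spiece (n.+1 - l) (fun j => N%:R ^+ l * iter l nabla c j) i%:Z).[N%:R * x - i%:R].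
  by rewrite spieceZ hornerZ /P -{1}(subnK ln) derivn_spiece.
have cP : continuous (P l).
  move=> x; apply: differentiable_continuous; apply/derivable1_diffP.
  by case: (dP l x).
have Pint a b := continuous_itv_integrable a b cP.
have wPl : locally_integrable setT (fun x => w x - P l x).
  apply: (locally_integrableB wl); split; first exact: continuous_measurable_fun.
    exact: openT.
  move=> K _ cK; have /integrableP[] //: mu.-integrable K (EFin \o P l).
  by apply: continuous_compact_integrable => //; exact: continuous_subspaceT.
have ab : node N i <= node N i.+1 :> R.
  by rewrite /node ler_pM2r ?invr_gt0 // ler_nat.
have H : {ae mu, forall x, node N i < x < node N i.+1 -> w x - P l x = 0}.
  apply: (du_bois_reymond wPl) => phi Tphi; have Tphi' := test_functionT Tphi.
  have cphi := classC_continuous (Tphi'.1 0%N).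
  have phi0 x := @test_function_support _ _ _ x Tphi.
  have supp (f : R -> R) : \int[mu]_x (f x * phi x) =
      \int[mu]_(x in `[node N i, node N i.+1]) (f x * phi x).
    apply: Rintegral_support => x; rewrite /= in_itv /= => xab.
    by rewrite phi0 ?mulr0.
  rewrite supp; under eq_Rintegral do rewrite mulrBl.
  rewrite RintegralB //; last 2 first.
  - by apply: itv_integrableM => //; exact: locally_integrable_itv.
  - by apply: itv_integrableM => //; exact: Pint.
  rewrite -!supp; have s0 : (-1) ^+ l != 0 :> R by rewrite signr_eq0.
  apply/eqP; rewrite subr_eq0; apply/eqP; apply: (mulfI s0).
  rewrite -Hw // -(Rintegral_parts l ab dP Tphi'.1 phi0).
  have supp' (f : R -> R) : \int[mu]_x (f x * derive1n l phi x) =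
      \int[mu]_(x in `[node N i, node N i.+1]) (f x * derive1n l phi x).
    apply: Rintegral_support => x; rewrite /= in_itv /= => xab.
    by rewrite (derive1n_support l phi0) ?mulr0.
  rewrite !supp'; apply: eq_Rintegral => x; rewrite inE /= in_itv /= /node.
  rewrite ler_pdivrMr // ler_pdivlMr // (mulrC x) => /andP[x1 x2].
  have ix : i%:Z%:~R <= N%:R * x <= i%:Z%:~R + 1 by rewrite -pmulrn x1 natr1.
  by rewrite vE (csp_cellc _ _ ix) /P mul1r derivn0 -pmulrn.
apply: filterS H; first exact: (ae_filter_ringOfSetsType mu).
by move=> x H xab; apply/eqP; rewrite -Pl -subr_eq0 H.
Qed.

End weak_derivative_uniqueness.

(** * Bounds on the projected coefficients *)

Section coefficient_estimates.
Context {R : realType}.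
Implicit Types (f g h u v : R -> R) (a b x M : R) (c d e : int -> R) (n l k N : nat).
Local Notation mu := (@lebesgue_measure R).

Lemma sum_periodic_window (F : int -> R) n N : periodic F N%:Z ->
  \sum_(i < N) \sum_(k < n.+1) F (i%:Z - k%:Z) = n.+1%:R * \sum_(i < N) F i%:Z.
Proof.
move=> FN; rewrite exchange_big /=.
under eq_bigr => k _ do rewrite (sum_periodic k%:Z FN).
by rewrite sumr_const card_ord mulr_natl.
Qed.

(** The upper counterpart of local stability: products of coefficients are split by
    [2 x y <= x^2 + y^2], and each coefficient enters [n + 1] cells. *)
Lemma cell_form_le n : exists2 C : R, 0 <= C & forall N e, periodic e N%:Z ->
  cell_form n N e e <= C * \sum_(i < N) e i%:Z ^+ 2.
Proof.
pose G : R := \sum_(k < n.+1) \sum_(j < n.+1) `|ip (bpiece n k) (bpiece n j)|.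
have G0 : 0 <= G by rewrite sumr_ge0 // => k _; exact: sumr_ge0.
have Gk (k j : 'I_n.+1) : `|ip (bpiece n k) (bpiece n j)| <= G.
  rewrite /G (bigD1 k) //= (bigD1 j) //= -addrA lerDl addr_ge0 ?sumr_ge0 //.
  by move=> i _; exact: sumr_ge0.
exists (G * n.+1%:R * n.+1%:R); first by rewrite !mulr_ge0.
move=> N e eN; have e2N : periodic (fun i => e i ^+ 2) N%:Z by move=> i; rewrite eN.
rewrite -mulrA -(sum_periodic_window n e2N) mulr_sumr; apply: ler_sum => i _.
rewrite {1}/spiece ip_suml.
apply: (@le_trans _ _ (\sum_(k < n.+1) \sum_(j < n.+1)
    G * ((e (i%:Z - k%:Z) ^+ 2 + e (i%:Z - j%:Z) ^+ 2) / 2))).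
  apply: ler_sum => k _; rewrite /spiece ip_sumr mulr_sumr; apply: ler_sum => j _.
  move: (Gk k j) (e (i%:Z - k%:Z)) (e (i%:Z - j%:Z)) => /ler_normlP[].
  move: (ip _ _) => z z1 z2 x y.
  have [xy|xy] := leP 0 (x * y).
    have : 0 <= (x * y) * (G - z) by rewrite mulr_ge0 ?subr_ge0.
    have : 0 <= G * (x - y) ^+ 2 by rewrite mulr_ge0 ?sqr_ge0.
    rewrite sqrrB; lra.
  have : 0 <= - (x * y) * (G + z) by rewrite mulr_ge0; lra.
  have : 0 <= G * (x + y) ^+ 2 by rewrite mulr_ge0 ?sqr_ge0.
  rewrite sqrrD; lra.
rewrite -mulrA le_eqVlt; apply/orP; left; apply/eqP.
under eq_bigr do rewrite -mulr_sumr.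
rewrite -mulr_sumr; congr (_ * _).
under eq_bigr do rewrite -mulr_suml big_split /= sumr_const card_ord.
rewrite -mulr_suml big_split /= sumr_const card_ord sumrMnl.
by rewrite -[_ *+ _]mulr_natl; field.
Qed.

Lemma csp_l1 n : exists2 C : R, 0 <= C & forall N e, (0 < N)%N -> periodic e N%:Z ->
  \int[mu]_(x in `[0, 1]) `|csp n.+1 e (N%:R * x)| <=
  N%:R^-1 * (C * \sum_(i < N) `|e i%:Z|).
Proof.
have [C C0 HC] := @spiece_bound R n.+1; exists (C * n.+2%:R).
  by rewrite mulr_ge0.
move=> N e N0 eN; have N0' : 0 < N%:R :> R by rewrite ltr0n.
have ch : continuous (fun x => `|csp n.+1 e (N%:R * x)|).
  by move=> x; apply: cvg_norm; exact: continuous_csp_scaled.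
rewrite (Rintegral_cells N0); last exact: continuous_itv_integrable.
have eaN : periodic (fun i => `|e i|) N%:Z by move=> i; rewrite eN.
rewrite -mulrA -(sum_periodic_window n.+1 eaN) !mulr_sumr; apply: ler_sum => i _.
pose M := C * \sum_(k < n.+2) `|e (i%:Z - k%:Z)|.
apply: (@le_trans _ _ (\int[mu]_(x in `[i%:R / N%:R, i.+1%:R / N%:R]) M)).
  apply: le_Rintegral => //.
  - exact: continuous_itv_integrable.
  - by apply: continuous_itv_integrable; exact: cst_continuous.
  move=> x; rewrite /= in_itv /= ler_pdivrMr // ler_pdivlMr // (mulrC x).
  move=> /andP[x1 x2].
  have ix : i%:Z%:~R <= N%:R * x <= i%:Z%:~R + 1 by rewrite -pmulrn x1 natr1.
  rewrite (csp_cellc _ _ ix); apply: HC; rewrite -pmulrn.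
  by rewrite subr_ge0 x1 lerBlDl natr1.
rewrite Rintegral_cst // /= lebesgue_measure_itv /= lte_fin.
rewrite ltr_pM2r ?invr_gt0 // ltr_nat ltnSn /= -mulrBl -natrB // subSnn mul1r.
by rewrite mulrC.
Qed.

(** The Gram system is tested with its own solution [d]: coercivity bounds the left side from below,
    and the spline tested against [g] has norm controlled by [d]. *)
Lemma projection_l2 n l : exists2 C : R, 0 <= C & forall N u g c,
  (n.+1 + l < N)%N -> periodic u 1 -> periodic g 1 -> periodic c N%:Z ->
  weak_derivative setT l u g ->
  L2_projection n.+2 N u (fun x => csp n.+1 c (N%:R * x)) ->
  mu.-integrable `[0, 1] (EFin \o (fun x => g x ^+ 2)) ->
  N%:R^-1 * \sum_(i < N) (N%:R ^+ l * iter l nabla c i%:Z) ^+ 2 <=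
  C * \int[mu]_(x in `[0, 1]) g x ^+ 2.
Proof.
have [K K0 HK] := @spiece_l2 R n.+1; have [C C0 HC] := cell_form_le (n + l).+1.
exists (K ^+ 2 * (C + 1)); first by rewrite mulr_ge0 ?sqr_ge0 // addr_ge0.
move=> N u g c nlN u1 g1 cN ug P gi.
have N0 : (0 < N)%N by exact: leq_ltn_trans nlN.
have N0' : 0 < N%:R :> R by rewrite ltr0n.
pose d i := N%:R ^+ l * iter l nabla c i.
have dN : periodic d N%:Z by move=> i; rewrite /d periodic_nabla.
have := projection_weak_derivative nlN u1 g1 cN dN ug P; rewrite -/d.
pose d' i := d (i + l%:Z).
have d'N : periodic d' N%:Z by move=> i; rewrite /d' addrAC dN.
set h := fun x => csp (n + l).+1 d' (N%:R * x) => PE.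
have ch : continuous h by exact: continuous_csp_scaled.
(* The Young parameter for which the term in [h] is at most half of the left side; [C + 1] keeps it
   positive. *)
pose lam := K * (C + 1); have C1 : 0 < C + 1 by rewrite ltr_wpDl.
have lam0 : 0 < lam by rewrite mulr_gt0.
have hi : mu.-integrable `[0, 1] (EFin \o (fun x => h x * h x)).
  by apply: itv_integrableM => //; exact: continuous_itv_integrable.
have gl := locally_integrable_itv 0 1 (let: And3 _ gl _ := ug in gl).
have H1 : \int[mu]_(x in `[0, 1]) (g x * h x) <=
    lam / 2 * \int[mu]_(x in `[0, 1]) g x ^+ 2 +
    (2 * lam)^-1 * \int[mu]_(x in `[0, 1]) (h x * h x).
  rewrite -!RintegralZl // -RintegralD //; [|exact: itv_integrableZ..].
  apply: le_Rintegral => //.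
  - exact: itv_integrableM.
  - have := integrableD _ (itv_integrableZ (lam / 2) gi)
      (itv_integrableZ (2 * lam)^-1 hi).
    by apply; exact: measurable_itv.
  move=> x _; have : 0 <= lam^-1 * (lam * g x - h x) ^+ 2.
    by rewrite mulr_ge0 ?sqr_ge0 // invr_ge0 ltW.
  have -> : lam^-1 * (lam * g x - h x) ^+ 2 =
      lam * g x ^+ 2 - 2 * (g x * h x) + lam^-1 * (h x * h x).
    by field; rewrite gt_eqF.
  by rewrite (invfM 2 lam); move: (lam^-1) (g x) (h x) => li y z; lra.
have H2 : \int[mu]_(x in `[0, 1]) (h x * h x) <= N%:R^-1 * (C * \sum_(i < N) d i%:Z ^+ 2).
  rewrite -[X in X <= _]/(inner01 h h) inner01_csp //.
  rewrite ler_wpM2l ?invr_ge0 ?ler0n // (le_trans (HC _ _ d'N)) //.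
  have d2N : periodic (fun i => d i ^+ 2) N%:Z by move=> i; rewrite dN.
  rewrite -[X in _ <= C * X](sum_periodic (- l%:Z) d2N) le_eqVlt; apply/orP; left.
  by apply/eqP; congr (_ * _); apply: eq_bigr => i _; rewrite /d' opprK.
have H3 : N%:R^-1 * \sum_(i < N) d i%:Z ^+ 2 <= K * (N%:R^-1 * cell_form n.+1 N d d).
  rewrite mulrCA ler_wpM2l ?invr_ge0 ?ler0n // mulr_sumr.
  by apply: ler_sum => i _; exact: HK.
rewrite PE in H3.
have S0 : 0 <= N%:R^-1 * \sum_(i < N) d i%:Z ^+ 2.
  by rewrite mulr_ge0 ?invr_ge0 ?ler0n // sumr_ge0 // => i _; exact: sqr_ge0.
move: H1 H2 H3 S0; rewrite (mulrCA _ C).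
move: (N%:R^-1 * _) => S; move: (\int[mu]_(x in _) _) => I1.
move: (\int[mu]_(x in _) _) => I2; move: (\int[mu]_(x in _) _) => I3.
move=> H1 H2 H3 S0.
have E : K * ((2 * lam)^-1 * I3) <= S / 2.
  have -> : K * ((2 * lam)^-1 * I3) = I3 / (2 * (C + 1)).
    by rewrite /lam; field; rewrite !gt_eqF.
  by rewrite ler_pdivrMr ?mulr_gt0 //; lra.
have := ler_wpM2l (ltW K0) H1; rewrite mulrDr => H4.
have E2 : K * (lam / 2 * I2) = K ^+ 2 * (C + 1) * I2 / 2 by rewrite /lam; field.
by rewrite E2 in H4; lra.
Qed.

(** Duality: [g] is bounded and the test spline has L^1 norm at most a multiple of the l^1 norm of
    its coefficients divided by [N]. This is exactly the bound on functionals that [cell_form_sup]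
    requires. *)
Lemma projection_sup n l : exists2 C : R, 0 <= C & forall N u g c M,
  (n.+1 + l < N)%N -> periodic u 1 -> periodic g 1 -> periodic c N%:Z ->
  weak_derivative setT l u g ->
  L2_projection n.+2 N u (fun x => csp n.+1 c (N%:R * x)) ->
  0 <= M -> {ae mu, forall x, `[0, 1]%classic x -> `|g x| <= M} ->
  forall i, `|N%:R ^+ l * iter l nabla c i| <= C * M.
Proof.
have [K K0 HK] := @cell_form_sup R n.+1; have [C C0 HC] := csp_l1 (n + l).
exists (K * C); first by rewrite mulr_ge0.
move=> N u g c M nlN u1 g1 cN ug P M0 gM.
have N0 : (0 < N)%N by exact: leq_ltn_trans nlN.
have N0' : 0 < N%:R :> R by rewrite ltr0n.
pose d i := N%:R ^+ l * iter l nabla c i.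
have dN : periodic d N%:Z by move=> i; rewrite /d periodic_nabla.
rewrite -mulrA; apply: (HK N d) => //; first by rewrite mulr_ge0.
move=> e eN.
have := projection_weak_derivative nlN u1 g1 cN eN ug P; rewrite -/d.
pose e' i := e (i + l%:Z).
have e'N : periodic e' N%:Z by move=> i; rewrite /e' addrAC eN.
set h := fun x => csp (n + l).+1 e' (N%:R * x) => PE.
have ch : continuous h by exact: continuous_csp_scaled.
have cah : continuous (fun x => `|h x|) by move=> x; apply: cvg_norm; exact: ch.
have gl := locally_integrable_itv 0 1 (let: And3 _ gl _ := ug in gl).
have ghi : mu.-integrable `[0, 1] (EFin \o (fun x => g x * h x)).
  exact: itv_integrableM.
have H1 : \int[mu]_(x in `[0, 1]) (g x * h x) <=
    M * \int[mu]_(x in `[0, 1]) `|h x|.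
  apply: le_trans (ler_norm _) _; apply: le_trans (le_normr_Rintegral _ ghi) _ => //.
  have ahi := continuous_itv_integrable 0 1 cah.
  have Mhi := itv_integrableZ M ahi.
  have agh := integrable_norm ghi.
  (* The bound on [g] holds only almost everywhere, so the integrals are compared in the extended
     reals. *)
  rewrite -RintegralZl // /Rintegral fine_le //.
  - exact: (integrable_fin_num _ agh).
  - exact: (integrable_fin_num _ Mhi).
  apply: ae_ge0_le_integral => //.
  - exact: measurable_int agh.
  - by move=> x _; rewrite lee_fin mulr_ge0.
  - exact: measurable_int Mhi.
  apply: filterS gM; first exact: (ae_filter_ringOfSetsType mu).
  by move=> x H Dx; rewrite lee_fin normrM ler_wpM2r // H.
have H2 := HC N e' N0 e'N; rewrite -/h in H2.
have eaN : periodic (fun i => `|e i|) N%:Z by move=> i; rewrite eN.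
have E : \sum_(i < N) `|e' i%:Z| = \sum_(i < N) `|e i%:Z|.
  rewrite -[RHS](sum_periodic (- l%:Z) eaN).
  by apply: eq_bigr => i _; rewrite /e' opprK.
rewrite E in H2.
have : N%:R^-1 * cell_form n.+1 N d e <= N%:R^-1 * (C * M * \sum_(i < N) `|e i%:Z|).
  rewrite PE (le_trans H1) // (le_trans (ler_wpM2l M0 H2)) //.
  by rewrite le_eqVlt; apply/orP; left; apply/eqP; ring.
by rewrite ler_pM2l // invr_gt0.
Qed.

End coefficient_estimates.

(** * Norms *)

Section norms.
Context {R : realType}.
Implicit Types (f g h u v w : R -> R) (a b x M : R) (c d e : int -> R) (n l k N : nat).
Local Notation mu := (@lebesgue_measure R).

Let mD : measurable (`[0, 1]%classic : set (measurableTypeR R)).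
Proof. exact: measurable_itv. Qed.

(** The norm at infinity tests whether the total mass is positive before taking an essential
    supremum. *)
Lemma lebesgue01T : lebesgue01 [set: measurableTypeR R] = 1%E.
Proof.
rewrite /lebesgue01 /= /mrestr setTI lebesgue_measure_itv /= lte_fin ltr01.
by rewrite oppr0 adde0.
Qed.

Lemma ae_lebesgue01P (P : R -> Prop) :
  {ae lebesgue01, forall x, P x} <->
  {ae mu, forall x, `[0, 1]%classic x -> P x}.
Proof.
split=> -[A [mA A0 PA]].
  exists (A `&` `[0, 1]); split => //; first exact: measurableI.
  by move=> x /= /not_implyP[Dx Px]; split => //; exact: PA.
exists (A `|` ~` `[0, 1]); split.
- by apply: measurableU => //; exact: measurableC.
- rewrite /lebesgue01 /= /mrestr setIUl setICl setU0.
  apply: (subset_measure0 _ _ _ A0) => //; exact: measurableI.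
- move=> x Px; have [Dx|Dx] := pselect (`[0, 1]%classic x); last by right.
  by left; apply: PA => H; apply: Px; exact: H.
Qed.

Lemma ge0_integral_lebesgue01 (f : R -> \bar R) :
  measurable_fun [set: measurableTypeR R] f -> (forall x, 0 <= f x)%E ->
  (\int[lebesgue01]_x f x = \int[mu]_(x in `[0%R, 1%R]) f x)%E.
Proof.
move=> mf f0; have mDC := measurableC mD.
rewrite -(setUv `[0%R, 1%R]%classic) ge0_integral_setU //=; last 2 first.
- by rewrite setUv.
- exact/disj_setPCl.
rewrite [X in (_ + X)%E]null_set_integral ?adde0 //; last 2 first.
- exact: measurable_funTS.
- by rewrite /lebesgue01 /= /mrestr setICl measure0.
by apply: eq_measure_integral => A mA AD; rewrite /lebesgue01 /= /mrestr setIidl.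
Qed.

Lemma L2normE f : measurable_fun [set: measurableTypeR R] f ->
  (L2norm f = (\int[mu]_(x in `[0%R, 1%R]) (f x ^+ 2)%:E) `^ 2^-1)%E.
Proof.
move=> mf; rewrite /L2norm unlock; congr (poweR _ _).
rewrite -ge0_integral_lebesgue01.
- apply: eq_integral => x _ /=; rewrite -[2]/(2%:R) powR_mulrn ?normr_ge0 //.
  by rewrite real_normK ?num_real.
- by apply/measurable_EFinP; exact: measurable_funX.
- by move=> x; rewrite lee_fin sqr_ge0.
Qed.

Lemma Linfnorm_leP f M : (Linfnorm f <= M%:E)%E <->
  {ae mu, forall x, `[0, 1]%classic x -> `|f x| <= M}.
Proof.
rewrite /Linfnorm unlock lebesgue01T lte01 -ae_lebesgue01P.
split=> [/ess_supP|H]; first by [].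
by apply/ess_supP.
Qed.

Lemma ge0_integral_cells f N : (0 < N)%N ->
  measurable_fun [set: measurableTypeR R] f -> (forall x, 0 <= f x) ->
  (\int[mu]_(x in `[0%R, 1%R]) (f x)%:E =
   \sum_(i < N) \int[mu]_(x in `[(i%:R / N%:R)%R, (i.+1%:R / N%:R)%R]) (f x)%:E)%E.
Proof.
move=> N0 mf f0; have N0' : 0 < N%:R :> R by rewrite ltr0n.
have mEf A : measurable_fun A (EFin \o f : measurableTypeR R -> _).
  by apply: measurable_funTS; exact/measurable_EFinP.
have H m : (\int[mu]_(x in `[0%R, (m%:R / N%:R)%R]) (f x)%:E =
   \sum_(i < m) \int[mu]_(x in `[(i%:R / N%:R)%R, (i.+1%:R / N%:R)%R]) (f x)%:E)%E.
  elim: m => [|m IH]; first by rewrite mul0r set_itv1 integral_set1 big_ord0.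
  rewrite big_ord_recr /= -IH.
  rewrite (@itv_bndbnd_setU _ _ _ (BLeft (m%:R / N%:R))); last 2 first.
  - by rewrite bnd_simp divr_ge0.
  - by rewrite bnd_simp ler_pM2r ?invr_gt0 // ler_nat.
  rewrite ge0_integral_setU //=; last 2 first.
  - by move=> x _; rewrite lee_fin.
  - apply/disj_setPRL => x /=; rewrite !in_itv /= => /andP[x1 _] /andP[_].
    by rewrite ltNge x1.
  by rewrite integral_itv_bndo_bndc //; exact: mEf.
by rewrite -H divff // gt_eqF.
Qed.

Lemma ae_in_cell N : (0 < N)%N ->
  {ae mu, forall x, `[0, 1]%classic x ->
    exists i, node N i < x < node N i.+1}.
Proof.
move=> N0; have N0' : 0 < N%:R :> R by rewrite ltr0n.
have H : {ae mu, forall x i, x <> node N i :> R}.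
  apply: ae_foralln => i; exists [set node N i]; split => //.
    exact: lebesgue_measure_set1.
  by move=> x /= /contrapT.
apply: filterS H; first exact: (ae_filter_ringOfSetsType mu).
move=> x Hx; rewrite /= in_itv /= => /andP[x0 x1].
have Nx0 : 0 <= N%:R * x by rewrite mulr_ge0 // ltW.
exists (Num.truncn (N%:R * x)); have /andP[t1 t2] := truncn_itv Nx0.
rewrite /node ltr_pdivlMr // (mulrC x) t2 andbT lt_neqAle.
rewrite ler_pdivrMr // (mulrC x) t1 andbT eq_sym.
exact/eqP/Hx.
Qed.

(** Here the sequence that solved the Gram system is read in degree [n.+1 - l], where it consists of
    the coefficients of the derivative. *)
Lemma spline_weak_derivative_sup n l : (l <= n.+1)%N -> exists2 C : R, 0 <= C &
  forall N c v w M, (0 < N)%N -> v = (fun x => csp n.+1 c (N%:R * x)) ->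
  weak_derivative setT l v w -> 0 <= M ->
  (forall i, `|N%:R ^+ l * iter l nabla c i| <= M) ->
  (Linfnorm w <= (C * M)%:E)%E.
Proof.
move=> ln; have [C C0 HC] := @spiece_bound R (n.+1 - l).
exists (C * (n.+1 - l).+1%:R); first by rewrite mulr_ge0.
move=> N c v w M N0 vE vw M0 HM; apply/Linfnorm_leP.
have N0' : 0 < N%:R :> R by rewrite ltr0n.
have Hc : {ae mu, forall x i, node N i < x < node N i.+1 -> w x =
    (spiece (n.+1 - l) (fun j => N%:R ^+ l * iter l nabla c j) i%:Z).[N%:R * x - i%:R]}.
  by apply: ae_foralln => i; exact: (weak_derivative_csp_cell i N0 ln vE vw).
have := ae_in_cell N0; move: Hc; apply: filterS2.
  exact: (ae_filter_ringOfSetsType mu).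
move=> x Hc Hx Dx; have [i ix] := Hx Dx; rewrite (Hc i ix).
move: ix; rewrite /node ltr_pdivrMr // ltr_pdivlMr // (mulrC x) => /andP[x1 x2].
have t01 : 0 <= N%:R * x - i%:R <= 1.
  by rewrite subr_ge0 ltW //= lerBlDl natr1 ltW.
rewrite (le_trans (HC _ _ _ t01)) // -mulrA ler_wpM2l //.
apply: (@le_trans _ _ (\sum_(k < (n.+1 - l).+1) M)).
  by apply: ler_sum => k _; exact: HM.
by rewrite sumr_const card_ord mulr_natl.
Qed.

Lemma spline_weak_derivative_l2 n l N c v w : (l <= n.+1)%N -> (0 < N)%N ->
  v = (fun x => csp n.+1 c (N%:R * x)) -> weak_derivative setT l v w ->
  (\int[mu]_(x in `[0%R, 1%R]) (w x ^+ 2)%:E =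
   (N%:R^-1 * cell_form (n.+1 - l) N
     (fun i => N%:R ^+ l * iter l nabla c i)
     (fun i => N%:R ^+ l * iter l nabla c i))%:E)%E.
Proof.
move=> ln N0 vE vw; have N0' : 0 < N%:R :> R by rewrite ltr0n.
have mw : measurable_fun [set: measurableTypeR R] w by case: vw => _ [mw _ _] _.
have mw2 : measurable_fun [set: measurableTypeR R] (fun x => w x ^+ 2).
  exact: measurable_funX.
rewrite (ge0_integral_cells N0) => [|//|x]; last exact: sqr_ge0.
rewrite /cell_form mulr_sumr -sumEFin; apply: eq_bigr => i _.
set p := spiece _ _ _.
pose q x : R := (p * p).[N%:R * x - i%:R].
have cq : continuous q.
  apply: (@classC_continuous _ 0); apply: classC_affine; apply/classC0.
  exact: continuous_horner.
rewrite /ip -(@Rintegral_cell_poly _ (p * p) N i) // -/q.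
rewrite /Rintegral fineK; last first.
  exact: (integrable_fin_num _ (continuous_itv_integrable _ _ cq)).
apply: ae_eq_integral => //.
- by apply: measurable_funTS; exact/measurable_EFinP.
- by apply: measurable_funTS; apply/measurable_EFinP; exact: continuous_measurable_fun.
have Hn (j : nat) : {ae mu, forall x, x <> node N j :> R}.
  exists [set node N j]; split => //; first exact: lebesgue_measure_set1.
  by move=> x /= /contrapT.
have Hc := weak_derivative_csp_cell i N0 ln vE vw.
have := Hn i.+1; have := Hn i; move: Hc; apply: filterS3.
  exact: (ae_filter_ringOfSetsType mu).
move=> x Hc H1 H2; rewrite /= in_itv /= => /andP[x1 x2]; congr EFin.
rewrite Hc -/p; first by rewrite /q hornerM expr2.
rewrite !lt_neqAle x1 x2 !andbT; apply/andP; split; apply/eqP => //.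
by move=> E; apply: H1.
Qed.

(** A weak derivative [g] of a periodic function need not be periodic at every point, as the
    coefficient estimates require. It is exchanged for the periodic representative [g'] supplied by
    [H_per], which agrees with it almost everywhere. *)
Lemma projection_stable n l : (l <= n.+1)%N ->
  exists C1 C2 : R, forall N, (n.+1 + l < N)%N ->
    (forall u v g w,
       H_per l u -> L2_projection n.+2 N u v ->
       weak_derivative setT l u g -> weak_derivative setT l v w ->
       (L2norm w <= C1%:E * L2norm g)%E) /\
    (forall u v g w,
       H_per l u -> L2_projection n.+2 N u v ->
       weak_derivative setT l u g -> weak_derivative setT l v w ->
       (Linfnorm w <= C2%:E * Linfnorm g)%E).
Proof.
move=> ln.
have [A A0 HA] := @projection_l2 R n l.
have [A' A'0 HA'] := @cell_form_le R (n.+1 - l).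
have [B B0 HB] := @projection_sup R n l.
have [B' B'0 HB'] := spline_weak_derivative_sup ln.
(* In the first constant the 1 avoids a square root, since [x <= (x + 1)^2]; in the second it gives
   positivity, so that the product is infinite when the norm of [g] is. *)
exists (A' * A + 1), (B' * B + 1) => N nlN.
have N0 : (0 < N)%N by exact: leq_ltn_trans nlN.
have N0' : 0 < N%:R :> R by rewrite ltr0n.
have setup u v g : H_per l u -> L2_projection n.+2 N u v ->
    weak_derivative setT l u g -> exists g' c, [/\
      L2_per g', weak_derivative setT l u g', periodic c N%:Z,
      v = (fun x => csp n.+1 c (N%:R * x)) &
      {ae mu, forall x, `[0, 1]%classic x -> g x = g' x}].
  move=> [_ /(_ l (leqnn l)) [g' g'L ug']] [sv _] ug.
  have [c cN vE] := spline_csp_ex N0 sv; exists g', c; split => //.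
  have := weak_derivative_unique (-1) 2 ug ug'; apply: filterS.
    exact: (ae_filter_ringOfSetsType mu).
  by move=> x H; rewrite /= in_itv /= => x01; apply: H; lra.
split=> u v g w uH P ug vw; have [g' [c [g'L ug' cN vE gg']]] := setup u v g uH P ug;
  have u1 := uH.1.1; have g1 := g'L.1; rewrite vE in P.
- have mg : measurable_fun [set: measurableTypeR R] g by case: ug => _ [mg _ _] _.
  have mg' : measurable_fun [set: measurableTypeR R] g' by case: ug' => _ [mg' _ _] _.
  have mw : measurable_fun [set: measurableTypeR R] w by case: vw => _ [mw _ _] _.
  have Eg : (\int[mu]_(x in `[0%R, 1%R]) (g x ^+ 2)%:E =
      \int[mu]_(x in `[0%R, 1%R]) (g' x ^+ 2)%:E)%E.
    apply: ae_eq_integral => //.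
    - by apply: measurable_funTS; apply/measurable_EFinP; exact: measurable_funX.
    - by apply: measurable_funTS; apply/measurable_EFinP; exact: measurable_funX.
    apply: filterS gg'; first exact: (ae_filter_ringOfSetsType mu).
    by move=> x H Dx; rewrite H.
  have gi : mu.-integrable `[0, 1] (EFin \o (fun x => g' x ^+ 2)).
    apply/integrableP; split.
      by apply: measurable_funTS; apply/measurable_EFinP; exact: measurable_funX.
    have -> : (\int[mu]_(x in `[0%R, 1%R]) `|(EFin \o (fun x => g' x ^+ 2)%R) x| =
        \int[mu]_(x in `[0%R, 1%R]) (g' x ^+ 2)%:E)%E.
      by apply: eq_integral => x _; rewrite /= ger0_norm ?sqr_ge0.
    have : (L2norm g' < +oo)%E.
      by have /andP[_] := g'L.2; rewrite inE.
    rewrite L2normE //; set I := (\int[mu]_(x in _) _)%E; have [//|] := ltP I +oo%E.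
    by rewrite leye_eq => /eqP ->; rewrite poweRyr ?ltxx ?invr_eq0.
  have := HA N u g' c nlN u1 g1 cN ug' P gi.
  rewrite !L2normE // Eg (spline_weak_derivative_l2 ln N0 vE vw).
  pose d i := N%:R ^+ l * iter l nabla c i.
  have dN : periodic d N%:Z by move=> i; rewrite /d periodic_nabla.
  set I := \int[mu]_(x in `[0, 1]) (g' x ^+ 2) => H1.
  have -> : (\int[mu]_(x in `[0%R, 1%R]) (g' x ^+ 2)%:E = I%:E)%E.
    by rewrite /I /Rintegral fineK //; exact: (integrable_fin_num _ gi).
  have I0 : 0 <= I by apply: Rintegral_ge0 => x _; exact: sqr_ge0.
  have AA0 : 0 <= A' * A by rewrite mulr_ge0.
  rewrite !poweR_EFin -EFinM lee_fin !powR12_sqrt //; last first.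
    rewrite mulr_ge0 ?invr_ge0 ?ler0n // sumr_ge0 // => i _; exact: ip_ge0.
  have C0 : 0 <= A' * A + 1 by rewrite addr_ge0.
  have CE : A' * A + 1 = Num.sqrt ((A' * A + 1) ^+ 2).
    by rewrite sqrtr_sqr ger0_norm.
  rewrite CE -sqrtrM ?sqr_ge0 //.
  apply: ler_wsqrtr; rewrite -/d.
  have H2 := HA' N d dN.
  have H3 : N%:R^-1 * cell_form (n.+1 - l) N d d <= A' * (A * I).
    apply: (@le_trans _ _ (A' * (N%:R^-1 * \sum_(i < N) d i%:Z ^+ 2))).
      by rewrite mulrCA ler_wpM2l ?invr_ge0 ?ler0n.
    by rewrite ler_wpM2l.
  rewrite (le_trans H3) // mulrA ler_wpM2r //; nra.
- have G0 : (0 <= Linfnorm g)%E by exact: Lnorm_ge0.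
  have C0 : 0 < B' * B + 1 by rewrite ltr_wpDl // mulr_ge0.
  case EG : (Linfnorm g) G0 => [M| |] //; last first.
    by move=> _; rewrite gt0_muley ?lte_fin // leey.
  rewrite lee_fin => M0.
  have /Linfnorm_leP gM : (Linfnorm g <= M%:E)%E by rewrite EG.
  have g'M : {ae mu, forall x, `[0, 1]%classic x -> `|g' x| <= M}.
    move: gg' gM; apply: filterS2; first exact: (ae_filter_ringOfSetsType mu).
    by move=> x H1 H2 Dx; rewrite -H1 // H2.
  have H1 := HB N u g' c M nlN u1 g1 cN ug' P M0 g'M.
  have BM0 : 0 <= B * M by rewrite mulr_ge0.
  apply: le_trans (HB' N c v w _ N0 vE vw BM0 H1) _.
  by rewrite -EFinM lee_fin mulrA ler_wpM2r // lerDl.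
Qed.

End norms.

Theorem proposition5p1 (R : realType) (r l : nat) :
  (2 <= r)%N -> (l <= r - 1)%N ->
  exists C1 C2 : R, forall N : nat, (4 * r <= N)%N ->
    (forall u v g w : R -> R,
       H_per l u -> L2_projection r N u v ->
       weak_derivative setT l u g -> weak_derivative setT l v w ->
       (L2norm w <= C1%:E * L2norm g)%E) /\
    (forall u v g w : R -> R,
       W_inf l u -> H_per l u -> L2_projection r N u v ->
       weak_derivative setT l u g -> weak_derivative setT l v w ->
       (Linfnorm w <= C2%:E * Linfnorm g)%E).
Proof.
case: r => [|[|n]] // _ ln; have ln' : (l <= n.+1)%N by lia.
have [C1 [C2 H]] := projection_stable (R := R) ln'.
(* With [r = n + 2] and [l <= n + 1], one has [n + 1 + l <= 2 n + 2 < 4 r]: B-splines of the raised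
   degree fit into one period. *)
exists C1, C2 => N nN; have nlN : (n.+1 + l < N)%N by lia.
have [H2 Hinf] := H N nlN.
by split=> [u v g w|u v g w _]; [exact: H2|exact: Hinf].
Qed.
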